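(* For $i\in\{0,\dots,M-1\}$ write $$v_i \triangleq \max_{q(\cdot|\cdot)}\ \min_{j\ne i}\ \sum_{\tilde y\in\mathcal Y,\,u\in\mathcal U}\mu_i^q(\tilde y)\,q(u|\tilde y)\,D\big(p_i^u(\cdot|\tilde y)\,\|\,p_j^u(\cdot|\tilde y)\big),$$ the maximum being over all conditional pmfs $q(u|\tilde y)$, $u\in\mathcal U$, $\tilde y\in\mathcal Y$. (Converse.) Any sequence of sequential tests $(\phi,N,\delta)$ with vanishing maximal probability of error, $P_{\max}\to 0$, satisfies for every $i=0,\dots,M-1$ $$\mathbb E_i[N]\ \ge\ \frac{-\log R_i}{v_i}\,(1+o(1))\ \ge\ \frac{-\log P_{\max}}{v_i}\,(1+o(1)).$$ (Achievability.) Consider the test $(\phi^*,N^*,\delta^* )$ with threshold $T>0$ described in the context, with exploration parameter $a>1$ sufficiently close to $1$, and let $P^*_{\max}$, $R^*_0,\dots,R^*_{M-1}$ be its maximal error probability and risks. Then $$P^*_{\max}\le \frac{M-1}{T}.$$ Furthermore, the test is asymptotically optimal: as $T\to\infty$, for each $i=0,\dots,M-1$, $$\mathbb E_i[N^*]=\frac{-\log P^*_{\max}}{v_i}(1+o(1))=\Big(\inf_{(\phi,N,\delta)\in\mathbb C(P^*_{\max})}\mathbb E_i[N]\Big)(1+o(1))$$ $$=\frac{-\log R^*_i}{v_i}(1+o(1))=\Big(\inf_{(\phi,N,\delta)\in\mathbb C'(R^*_0,\dots,R^*_{M-1})}\mathbb E_i[N]\Big)(1+o(1)).$$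
   Context: Observation model. $\mathcal Y$ (observations) and $\mathcal U$ (controls) are finite sets; there are $M$ hypotheses $0,\dots,M-1$. For each hypothesis $i$ and $u\in\mathcal U$, $p_i^u(\cdot|\cdot)$ is a given transition probability from $\mathcal Y$ to itself, and $p_i^u(y|\tilde y)>0$ for all $i,u,y,\tilde y$. The initial observation $y_0$ is a constant. Under hypothesis $i$, conditioned on $(u_k,y_{k-1})$, the observation $Y_k$ is conditionally independent of all earlier observations and controls $(y^{k-2},u^{k-1})$ and has distribution $p_i^{u_k}(\cdot|y_{k-1})$, $k=1,2,\dots$. Here $y^k=(y_1,\dots,y_k)$, $u^k=(u_1,\dots,u_k)$. Policies and tests. A causal control policy $\phi$ is a collection of conditional pmfs $q_1(u_1|y_0)$ and $q_k(u_k|y^{k-1},u^{k-1})$, $k\ge2$, specifying the (randomized) control $U_k$. Under hypothesis $i$ the joint pmf is $$p_i(y^n,u^n)=q_1(u_1|y_0)\prod_{k=1}^n p_i^{u_k}(y_k|y_{k-1})\prod_{k=2}^n q_k(u_k|y^{k-1},u^{k-1}).$$ $\mathbb P_i,\mathbb E_i$ denote probability and expectation under hypothesis $i$. A sequential test $(\phi,N,\delta)$ consists of a causal control policy $\phi$, a stopping time $N$ with respect to $\mathcal F_k=\sigma(Y^k,U^k)$, and a decision rule $\delta=\delta(Y^N,U^N)\in\{0,\dots,M-1\}$. Error criteria. $P_{\max}=\max_i\mathbb P_i\{\delta\ne i\}$; the risks are $R_i=\max_{j\ne i}\mathbb P_j\{\delta=i\}$. $\mathbb C(\alpha)$ is the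 class of tests with $P_{\max}\le\alpha$, and $\mathbb C'(\beta_0,\dots,\beta_{M-1})$ the class of tests with $R_i\le\beta_i$ for all $i$. $D(p_1\|p_2)=\sum_y p_1(y)\log\frac{p_1(y)}{p_2(y)}$ is the Kullback–Leibler distance. Stationary distributions. For a conditional pmf $q(u|\tilde y)$, $\mu_i^q$ is the unique stationary distribution of the transition probabilities $p_i^q(y|\tilde y)=\sum_{u}q(u|\tilde y)p_i^u(y|\tilde y)$ on $\mathcal Y$. The test $(\phi^*,N^*,\delta^* )$. For each $i$ let $q_i^*(\cdot|\cdot)$ be a maximizer over conditional pmfs $q(\cdot|\cdot)$ of $\min_{j\ne i}\sum_{\tilde y,u}\mu_i^q(\tilde y)q(u|\tilde y)D(p_i^u(\cdot|\tilde y)\|p_j^u(\cdot|\tilde y))$. Let $\hat i_n=\operatorname{argmax}_{i}p_i(Y^n,U^n)$ be the maximum likelihood (ML) estimate of the hypothesis. The policy $\phi^*$: at times $k=\lceil a^\ell\rceil$, $\ell=0,1,2,\dots$, $U_k$ is uniformly distributed on $\mathcal U$, independently of all past observations and controls; at all other times $U_k\sim q^*_{\hat i_{k-1}}(\cdot|y_{k-1})$. Here $a>1$ is a fixed constant chosen sufficiently close to $1$. The stopping time is $$N^*=\min\Big\{n\ge1:\ \frac{p_{\hat i_n}(Y^n,U^n)}{\max_{j\ne\hat i_n}p_j(Y^n,U^n)}>T\Big\},$$ and $\delta^*=\hat i_{N^*}$. *)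

(* Defs.v *)
From HB Require Import structures.
From mathcomp Require Import all_boot all_order all_algebra.
From mathcomp Require Import all_classical all_reals all_analysis.

Set Implicit Arguments.
Unset Strict Implicit.
Unset Printing Implicit Defensive.

Import Order.TTheory GRing.Theory Num.Theory.
Import numFieldNormedType.Exports.
Local Open Scope classical_set_scope.
Local Open Scope ring_scope.

(* A history is the chronological sequence (u_1,y_1), ..., (u_n,y_n).
   The kernel [p i u yt y] is p_i^u(y|yt), a conditional pmf [q yt u] is q(u|yt),
   and a control law [q h u] is q_k(u|y^{k-1},u^{k-1}) with k = size h + 1. *)

Definition is_pmf (R : realType) (T : finType) (f : T -> R) : Prop :=
  (forall x, 0 <= f x) /\ \sum_x f x = 1.

Section Kernels.
Context {R : realType} {Y U : finType} {M : nat}.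
Implicit Types (p : 'I_M -> U -> Y -> Y -> R) (q : Y -> U -> R) (i j : 'I_M).

Definition kl_div (p1 p2 : Y -> R) : R := \sum_y p1 y * ln (p1 y / p2 y).

Definition cond_pmf q : Prop := forall yt, is_pmf (q yt).

Definition mixed_kernel p i q (yt y : Y) : R := \sum_u q yt u * p i u yt y.

Definition stationary (K : Y -> Y -> R) (mu : {ffun Y -> R}) : Prop :=
  is_pmf mu /\ forall y, \sum_yt mu yt * K yt y = mu y.

(* A stationary distribution exists and is unique when [K] is a positive
   stochastic kernel; the default value 0 is then never taken. *)
Definition stat_dist (K : Y -> Y -> R) : {ffun Y -> R} :=
  xget [ffun=> 0] [set mu | stationary K mu].

Definition info_rate p i j q : R :=
  \sum_yt \sum_u
    stat_dist (mixed_kernel p i q) yt * q yt u * kl_div (p i u yt) (p j u yt).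

(* A minimum: the set is finite, and nonempty as soon as 1 < M. *)
Definition min_info p i q : R :=
  inf [set x | exists2 j, j != i & x = info_rate p i j q].

Definition v_opt p i : R := sup [set min_info p i q | q in cond_pmf].

Definition is_maximizer p i q : Prop :=
  cond_pmf q /\ forall q', cond_pmf q' -> min_info p i q' <= min_info p i q.

(* For k = 0 the factor of [q] is q_1(u_1|y_0); the observation preceding
   y_{k+1} is entry k of y_0, y_1, ..., y_n. *)
Definition joint_pmf p (y0 : Y) (q : seq (U * Y) -> U -> R) i
    (h : seq (U * Y)) : R :=
  (\prod_(k < size h) q (take k h) (tnth (in_tuple h) k).1) *
  \prod_(k < size h)
    p i (tnth (in_tuple h) k).1 (nth y0 (y0 :: unzip2 h) k)
        (tnth (in_tuple h) k).2.

End Kernels.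

(* [step k] is the pair (U_{k+1}, Y_{k+1}). *)
Record controlled_process (R : realType) (Y U : finType) (M : nat)
    (p : 'I_M -> U -> Y -> Y -> R) (y0 : Y) := ControlledProcess {
  policy : seq (U * Y) -> U -> R ;
  policy_pmf : forall h, is_pmf (policy h) ;
  disp : measure_display ;
  space : measurableType disp ;
  prob : 'I_M -> probability space R ;
  step : nat -> space -> U * Y ;
  measurable_step : forall k x, measurable [set w | step k w = x] ;
  step_law : forall i h,
    prob i [set w | mkseq (step ^~ w) (size h) = h]
      = (joint_pmf p y0 policy i h)%:E }.

Section Tests.
Context {R : realType} {Y U : finType} {M : nat}.
Context {p : 'I_M -> U -> Y -> Y -> R} {y0 : Y}.
Implicit Types X : controlled_process p y0.

Definition hist X n (w : space X) : seq (U * Y) := mkseq (@step _ _ _ _ _ _ X ^~ w) n.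

Definition filtration X n : set (set (space X)) :=
  preimage_set_system setT (@hist X n) setT.

(* [None] is the value +oo. *)
Definition stopping_time X (N : space X -> option nat) : Prop :=
  forall n, filtration n [set w | exists2 m, (m <= n)%N & N w = Some m].

End Tests.

Record sequential_test (R : realType) (Y U : finType) (M : nat)
    (p : 'I_M -> U -> Y -> Y -> R) (y0 : Y) := SequentialTest {
  process : controlled_process p y0 ;
  stop : space process -> option nat ;
  stop_stopping : stopping_time stop ;
  rule : seq (U * Y) -> 'I_M }.

Section Criteria.
Context {R : realType} {Y U : finType} {M : nat}.
Context {p : 'I_M -> U -> Y -> Y -> R} {y0 : Y}.
Local Open Scope ereal_scope.
Implicit Types (t : sequential_test p y0) (i j : 'I_M).

Definition pr t i : probability (space (process t)) R := prob (process t) i.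

(* No decision is made on the event that the test never stops. *)
Definition decision t (w : space (process t)) : option 'I_M :=
  omap (fun n => rule t (hist n w)) (stop w).

Definition Pmax t : \bar R :=
  \big[maxe/0]_(i < M)
    pr t i [set w | exists2 j, decision w = Some j & j != i].

Definition risk t i : \bar R :=
  \big[maxe/0]_(j < M | j != i) pr t j [set w | decision w = Some i].

Definition mean_time t i : \bar R :=
  \int[pr t i]_w oapp (fun n : nat => n%:R%:E) +oo (stop w).

Definition class_Pmax (alpha : \bar R) t : Prop := Pmax t <= alpha.

Definition class_risk (beta : 'I_M -> \bar R) t : Prop :=
  forall i, risk t i <= beta i.

(* [C] is not a [set] because sequential tests, which carry their sample space,
   live in a universe above that of [set]. *)
Definition inf_mean_time (C : sequential_test p y0 -> Prop) i : \bar R :=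
  ereal_inf [set x | exists2 t, C t & x = mean_time t i].

End Criteria.

Arguments class_Pmax {R Y U M} p y0 alpha t.
Arguments class_risk {R Y U M} p y0 beta t.

Section StarTest.
Context {R : realType} {Y U : finType} {M : nat}.
Context {p : 'I_M -> U -> Y -> Y -> R} {y0 : Y}.
Implicit Types (X : controlled_process p y0) (mle : seq (U * Y) -> 'I_M).

Definition exploration (a : R) (k : nat) : Prop :=
  exists l : nat, k%:Z = Num.ceil (a ^+ l).

Definition star_policy (a : R) (qs : 'I_M -> Y -> U -> R) mle
    (h : seq (U * Y)) (u : U) : R :=
  if `[< exploration a (size h).+1 >] then #|U|%:R^-1
  else qs (mle h) (last y0 (unzip2 h)) u.

(* Any tie-breaking in the argmax is allowed. *)
Definition is_mle X mle : Prop :=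
  forall h j, joint_pmf p y0 (policy X) j h
                <= joint_pmf p y0 (policy X) (mle h) h.

Definition star_stop_at X mle (T : R) (h : seq (U * Y)) : bool :=
  (0 < size h)%N &&
  (T < joint_pmf p y0 (policy X) (mle h) h /
       \big[Num.max/0]_(j < M | j != mle h) joint_pmf p y0 (policy X) j h).

Definition star_time X mle (T : R) (w : space X) : option nat :=
  match pselect (exists n, star_stop_at X mle T (hist n w)) with
  | left ex => Some (ex_minn ex)
  | right _ => None
  end.

Lemma take_hist X m n (w : space X) : (m <= n)%N -> take m (hist n w) = hist m w.
Proof.
by move=> mn; rewrite /hist /mkseq -map_take take_iota (minn_idPl mn).
Qed.

Lemma star_time_stopping X mle T : stopping_time (@star_time X mle T).
Proof.
move=> n; exists [set h | exists2 m, (m <= n)%N & star_stop_at X mle T (take m h)] => //.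
rewrite setTI; apply/seteqP; split=> w /=.
- move=> [m mn]; rewrite take_hist// => sm.
  rewrite /star_time; case: pselect => [ex|[]]; last by exists m.
  by case: ex_minnP => k _ /(_ _ sm) km; exists k => //; exact: leq_trans mn.
- move=> [m mn]; rewrite /star_time; case: pselect => // ex.
  by case: ex_minnP => k sk _ [km]; exists m => //; rewrite take_hist// -km.
Qed.

Definition star_test X mle (T : R) : sequential_test p y0 :=
  SequentialTest (@star_time_stopping X mle T) mle.

End StarTest.

Arguments star_policy {R Y U M} y0 a qs mle h u.

(* f = g (1 + o(1)) along the filter F *)
Definition asymp_eq (R : realType) (I : Type) (F : set_system I)
    (f g : I -> \bar R) : Prop :=
  exists2 e : I -> R, e @ F --> (0 : R) &
    \forall t \near F, f t = (g t * (1 + e t)%:E)%E.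

(* Main.v *)
Require Import Defs.
From HB Require Import structures.
From mathcomp Require Import all_boot all_order all_algebra.
From mathcomp Require Import all_classical all_reals all_analysis.
From mathcomp Require Import measurable_realfun ring lra zify.

(** The finite alphabets make every event decided after [n] steps a finite set of
   histories of length [n], so both halves of the theorem are statements on
   finite sums ([expect]); they meet the probability spaces only through
   [prob_hist], [decision_prob] and [mean_timeE], the last of which writes the
   mean stopping time as the sum of the probabilities of surviving [n] steps.

   Converse. Fix [i], and let a test declare [i] with probability nearly 1 under
   [i] but at most the risk [l] under any other [j]. By a change of measure the
   expected log-likelihood ratio of [i] to [j] at the stopping time is at least
   about [- ln l] ([stopped_information]). It is also the integral of the
   Kullback-Leibler distances against the expected number of visits of each pair
   (observation, control). This occupation measure is invariant up to mass 2
   under the kernel of the stationary control obtained by disintegrating it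
   ([flow_balance]). All kernels being bounded below by some [c > 0], it differs
   from the mean stopping time times the stationary distribution by a bounded
   amount ([near_stationary]). So, for the worst [j], the expected log-likelihood
   ratio is at most [v_opt p i] times the mean stopping time plus a constant that
   depends on the kernels only ([converse_bound]). As [Pmax] tends to 0, [- ln l]
   tends to infinity and the constant is negligible. The bound being uniform, it
   applies to the infima over classes of tests as well.

   Achievability. A change of measure from [j] to the declared hypothesis, which
   is [T] times likelier, bounds [Pmax] by [(M - 1) / T] ([star_Pmax]). The main
   point is an upper bound for the mean time under [i] when [v_opt p i > 0], so
   that [i] differs from every other hypothesis. Each exploration step multiplies
   the Bhattacharyya coefficient of [i] and [j] by at most a constant less than 1
   ([exploration_rate]). As exploration times grow like [a ^+ l], the estimate
   errs at time [n] with probability of the order of [n ^- 3] for [a] close to 1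
   ([mistake_bound]). Hence, apart from late errors, the control is the one
   optimal for [i] at all but a small fraction of the steps; where it is, the
   Poisson equation turns the log-likelihood ratio, minus its drift, into a
   martingale with bounded increments, whose large deviations are exponentially
   small ([llr_deviation]). So the probability that the log-likelihood ratio
   after [n] steps is below [n] times a number less than [v_opt p i] is summable
   ([llr_small_summable]), and the mean time is at most
   [(1 + e) * ln T / v_opt p i] plus a constant ([star_mean_time]).

   The two bounds meet at [ln T / v_opt p i]. If [v_opt p i = 0], the converse
   shows that all the quantities compared are infinite for [T] large. *)

Set Implicit Arguments.
Unset Strict Implicit.
Unset Printing Implicit Defensive.

Import Order.TTheory GRing.Theory Num.Theory.
Import numFieldNormedType.Exports.
Local Open Scope classical_set_scope.
Local Open Scope ring_scope.

(* the sample space, not the inductive type of the theory of vector spaces *)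
Local Notation space := Defs.space.

(** * Expectations over finite histories *)

Section History.
Context {R : realType} {Y U : finType} (y0 : Y).
Implicit Types (q : seq (U * Y) -> U -> R) (w : U -> Y -> Y -> R)
  (f g : seq (U * Y) -> R) (s : seq (U * Y) -> U * Y -> R) (h : seq (U * Y))
  (x : U * Y).

Definition last_obs h : Y := last y0 (unzip2 h).

Lemma last_obs_rcons h x : last_obs (rcons h x) = x.2.
Proof. by rewrite /last_obs /unzip2 map_rcons last_rcons. Qed.

(** The weights [w] need not be probabilities: geometric means of two kernels
   are used as well. *)
Definition next q w h (g : U * Y -> R) : R :=
  \sum_x q h x.1 * w x.1 (last_obs h) x.2 * g x.

Fixpoint expect q w (n : nat) f : R :=
  if n is m.+1 then expect q w m (fun h => next q w h (fun x => f (rcons h x)))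
  else f [::].

Lemma expectS q w n f :
  expect q w n.+1 f = expect q w n (fun h => next q w h (fun x => f (rcons h x))).
Proof. by []. Qed.

(** Log-likelihood ratios and counts of exceptional steps have this form. *)
Definition path_sum s h : R :=
  \sum_(k < size h) s (take k h) (tnth (in_tuple h) k).

Lemma big_size_rcons (S : Type) (idx : S) (op : Monoid.law idx)
    (F : seq (U * Y) -> U * Y -> S) h x :
  \big[op/idx]_(k < size (rcons h x))
     F (take k (rcons h x)) (tnth (in_tuple (rcons h x)) k)
  = op (\big[op/idx]_(k < size h) F (take k h) (tnth (in_tuple h) k)) (F h x).
Proof.
transitivity (\big[op/idx]_(k < (size h).+1) F (take k (rcons h x)) (nth x (rcons h x) k)).
  rewrite -(big_mkord xpredT (fun k => F (take k (rcons h x)) (nth x (rcons h x) k))).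
  rewrite -(size_rcons h x) big_mkord; apply: eq_bigr => k _.
  by rewrite (tnth_nth x).
rewrite big_ord_recr/= nth_rcons ltnn eqxx.
have -> : take (size h) (rcons h x) = h by rewrite -cats1 take_size_cat.
congr (op _ _); apply: eq_bigr => k _.
by rewrite nth_rcons ltn_ord (tnth_nth x) -cats1 takel_cat// ltnW.
Qed.

Lemma path_sum_nil s : path_sum s [::] = 0.
Proof. by rewrite /path_sum big_ord0. Qed.

Lemma path_sum_rcons s h x : path_sum s (rcons h x) = path_sum s h + s h x.
Proof. exact: (big_size_rcons +%R). Qed.

Lemma nextD q w h (g1 g2 : U * Y -> R) :
  next q w h (fun x => g1 x + g2 x) = next q w h g1 + next q w h g2.
Proof. by rewrite /next -big_split; apply: eq_bigr => x _; rewrite mulrDr. Qed.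

Lemma nextZ q w h c (g : U * Y -> R) : next q w h (fun x => c * g x) = c * next q w h g.
Proof. by rewrite /next mulr_sumr; apply: eq_bigr => x _; rewrite mulrCA. Qed.

Lemma eq_next q w h (g1 g2 : U * Y -> R) : g1 =1 g2 -> next q w h g1 = next q w h g2.
Proof. by move=> e; apply: eq_bigr => x _; rewrite e. Qed.

Lemma next_pair q w h (g : U * Y -> R) :
  next q w h g = \sum_u q h u * \sum_y w u (last_obs h) y * g (u, y).
Proof.
transitivity (\sum_x q h x.1 * w x.1 (last_obs h) x.2 * g (x.1, x.2)).
  by apply: eq_bigr => -[].
rewrite -(pair_bigA _ (fun u y => q h u * w u (last_obs h) y * g (u, y)))/=.
by apply: eq_bigr => u _; rewrite mulr_sumr; apply: eq_bigr => y _; rewrite mulrA.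
Qed.

Lemma next_cst q w h c : is_pmf (q h) -> (forall u yt, is_pmf (w u yt)) ->
  next q w h (fun=> c) = c.
Proof.
move=> [_ q1] w1; rewrite next_pair.
under eq_bigr => u _ do rewrite -mulr_suml (w1 u (last_obs h)).2 mul1r.
by rewrite -mulr_suml q1 mul1r.
Qed.

Lemma eq_expect q w n f g : (forall h, size h = n -> f h = g h) ->
  expect q w n f = expect q w n g.
Proof.
elim: n f g => [|n IH] f g fg /=; first exact: fg.
by apply: IH => h hn; apply: eq_next => x; apply: fg; rewrite size_rcons hn.
Qed.

Lemma expectD q w n f g :
  expect q w n (fun h => f h + g h) = expect q w n f + expect q w n g.
Proof.
elim: n f g => [//|n IH] f g /=.
by rewrite -IH; apply: eq_expect => h _; exact: nextD.
Qed.

Lemma expectZ q w n c f : expect q w n (fun h => c * f h) = c * expect q w n f.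
Proof.
elim: n f => [//|n IH] f /=.
by rewrite -IH; apply: eq_expect => h _; exact: nextZ.
Qed.

Lemma expectN q w n f : expect q w n (fun h => - f h) = - expect q w n f.
Proof.
by rewrite -[RHS]mulN1r -expectZ; apply: eq_expect => h _; rewrite mulN1r.
Qed.

Lemma expectB q w n f g :
  expect q w n (fun h => f h - g h) = expect q w n f - expect q w n g.
Proof. by rewrite expectD expectN. Qed.

Lemma expect0 q w n : expect q w n (fun=> 0) = 0.
Proof.
transitivity (expect q w n (fun=> 0 * 0)); first by apply: eq_expect => h _; rewrite mul0r.
by rewrite (expectZ q w n 0 (fun=> 0)) mul0r.
Qed.

Lemma expect_sum q w n (I : Type) (r : seq I) (P : pred I) (F : I -> seq (U * Y) -> R) :
  expect q w n (fun h => \sum_(i <- r | P i) F i h)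
  = \sum_(i <- r | P i) expect q w n (F i).
Proof.
elim: r => [|i r IH].
  by rewrite big_nil -[RHS](expect0 q w n); apply: eq_expect => h _; rewrite big_nil.
rewrite big_cons -IH; case: ifPn => Pi.
  by rewrite -expectD; apply: eq_expect => h _; rewrite big_cons Pi.
by apply: eq_expect => h _; rewrite big_cons (negbTE Pi).
Qed.

Section Positive.
Variables (q : seq (U * Y) -> U -> R) (w : U -> Y -> Y -> R).
Hypotheses (q_ge0 : forall h u, 0 <= q h u) (w_ge0 : forall u yt y, 0 <= w u yt y).

Lemma le_next h (g1 g2 : U * Y -> R) : (forall x, g1 x <= g2 x) ->
  next q w h g1 <= next q w h g2.
Proof. by move=> g12; apply: ler_sum => x _; apply: ler_wpM2l => //; exact: mulr_ge0. Qed.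

Lemma le_expect n f g : (forall h, size h = n -> f h <= g h) ->
  expect q w n f <= expect q w n g.
Proof.
elim: n f g => [|n IH] f g fg /=; first exact: fg.
by apply: IH => h hn; apply: le_next => x; apply: fg; rewrite size_rcons hn.
Qed.

Lemma expect_ge0 n f : (forall h, size h = n -> 0 <= f h) -> 0 <= expect q w n f.
Proof. by move=> f0; rewrite -[leLHS](expect0 q w n); exact: le_expect. Qed.

End Positive.

Section Stochastic.
Variables (q : seq (U * Y) -> U -> R) (w : U -> Y -> Y -> R).
Hypotheses (q_pmf : forall h, is_pmf (q h)) (w_pmf : forall u yt, is_pmf (w u yt)).

Lemma expect_cst n c : expect q w n (fun=> c) = c.
Proof.
elim: n => [//|n IH] /=; rewrite -[RHS]IH.
by apply: eq_expect => h _; exact: next_cst.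
Qed.

(** Each of the last [n - m] steps sums out to a factor 1. *)
Lemma expect_take m n f : (m <= n)%N ->
  expect q w n (fun h => f (take m h)) = expect q w m f.
Proof.
elim: n => [|n IH]; first by rewrite leqn0 => /eqP ->.
rewrite leq_eqVlt => /predU1P[->|mn].
  by apply: eq_expect => h hn; rewrite take_oversize// hn.
rewrite -IH//=; apply: eq_expect => h hn.
rewrite -[RHS](next_cst _ (q_pmf h) w_pmf); apply: eq_next => x.
by rewrite -cats1 takel_cat// hn.
Qed.

End Stochastic.

(** Change of measure: with [s] a log-likelihood ratio this passes from one
   hypothesis to another, with half of it to the geometric mean of the two. *)
Lemma expect_tilt q w w' s n f :
  (forall h x, w' x.1 (last_obs h) x.2 = w x.1 (last_obs h) x.2 * expR (s h x)) ->
  expect q w' n f = expect q w n (fun h => expR (path_sum s h) * f h).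
Proof.
move=> ww'; elim: n f => [|n IH] f /=; first by rewrite path_sum_nil expR0 mul1r.
rewrite IH; apply: eq_expect => h _; rewrite -nextZ; apply: eq_bigr => x _.
by rewrite path_sum_rcons expRD ww'; ring.
Qed.

End History.

Section Joint.
Context {R : realType} {Y U : finType} {M : nat} (y0 : Y)
  (p : 'I_M -> U -> Y -> Y -> R).
Implicit Types (q : seq (U * Y) -> U -> R) (h : seq (U * Y)) (x : U * Y).

Lemma joint_pmf_nil q i : joint_pmf p y0 q i [::] = 1.
Proof. by rewrite /joint_pmf !big_ord0 mulr1. Qed.

Lemma joint_pmf_rcons q i h x :
  joint_pmf p y0 q i (rcons h x)
  = joint_pmf p y0 q i h * (q h x.1 * p i x.1 (last_obs y0 h) x.2).
Proof.
have E h' : \prod_(k < size h') p i (tnth (in_tuple h') k).1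
      (nth y0 (y0 :: unzip2 h') k) (tnth (in_tuple h') k).2
    = \prod_(k < size h') p i (tnth (in_tuple h') k).1 (last_obs y0 (take k h'))
        (tnth (in_tuple h') k).2.
  apply: eq_bigr => k _; suff -> : last_obs y0 (take k h') = nth y0 (y0 :: unzip2 h') k by [].
  rewrite /last_obs /unzip2 map_take (last_nth y0) size_takel; last first.
    by rewrite size_map ltnW.
  by case: (nat_of_ord k) => [//|m] /=; rewrite nth_take.
rewrite /joint_pmf !E (big_size_rcons *%R (fun h x => q h x.1)).
rewrite (big_size_rcons *%R (fun h x => p i x.1 (last_obs y0 h) x.2)) /=.
by rewrite mulrACA.
Qed.

(** Likelihoods compare well only on histories of positive probability: where
   the policy vanishes, all the likelihoods do. *)
Lemma le_expect_support q i n (f g : seq (U * Y) -> R) :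
  (forall h u, 0 <= q h u) -> (forall u yt y, 0 < p i u yt y) ->
  (forall h, size h = n -> 0 < joint_pmf p y0 q i h -> f h <= g h) ->
  expect y0 q (p i) n f <= expect y0 q (p i) n g.
Proof.
move=> q0 p0; elim: n f g => [|n IH] f g fg /=.
  by apply: fg => //; rewrite joint_pmf_nil.
apply: IH => h hn h0; apply: ler_sum => x _.
have := q0 h x.1; rewrite le_eqVlt => /predU1P[<-|q1]; first by rewrite !mul0r.
apply: ler_wpM2l; first by rewrite mulr_ge0// ltW.
apply: fg; first by rewrite size_rcons hn.
by rewrite joint_pmf_rcons; apply: mulr_gt0 => //; exact: mulr_gt0.
Qed.

(** The law of a process is given through the probabilities of single histories;
   this links them to the recursive expectation. *)
Lemma expect_delta q i h0 :
  expect y0 q (p i) (size h0) (fun h => (h == h0)%:R) = joint_pmf p y0 q i h0.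
Proof.
elim/last_ind: h0 => [|h0 x0 IH]; first by rewrite joint_pmf_nil.
rewrite size_rcons /= joint_pmf_rcons -IH mulrC -expectZ; apply: eq_expect => h _.
rewrite /next (bigD1 x0)//= big1 ?addr0 => [|x /negbTE xx0].
  by rewrite eqseq_rcons eqxx andbT; case: eqP => [->//|]; rewrite !mulr0.
by rewrite eqseq_rcons xx0 andbF mulr0.
Qed.

Lemma expectE q i n (f : seq (U * Y) -> R) :
  expect y0 q (p i) n f = \sum_(t : n.-tuple (U * Y)) f t * joint_pmf p y0 q i t.
Proof.
transitivity (expect y0 q (p i) n
    (fun h => \sum_(t : n.-tuple (U * Y)) f t * (h == t)%:R)).
  apply: eq_expect => h /eqP hn; rewrite (bigD1 (Tuple hn))//= eqxx mulr1.
  rewrite big1 ?addr0// => t; rewrite eq_sym -val_eqE /= => /negbTE ->.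
  by rewrite mulr0.
rewrite expect_sum; apply: eq_bigr => t _.
by rewrite expectZ -expect_delta size_tuple.
Qed.

End Joint.

Arguments expect : simpl never.

(** * Events and times seen through histories *)

Section Process.
Context {R : realType} {Y U : finType} {M : nat} {p : 'I_M -> U -> Y -> Y -> R}
  {y0 : Y}.
Implicit Types (X : controlled_process p y0) (h : seq (U * Y))
  (alive : pred (seq (U * Y))).

Lemma hist0 X (w : space X) : hist 0 w = [::].
Proof. by []. Qed.

Lemma histS X n (w : space X) : hist n.+1 w = rcons (hist n w) (step n w).
Proof. exact: mkseqS. Qed.

Lemma size_hist X n (w : space X) : size (hist n w) = n.
Proof. exact: size_mkseq. Qed.

Lemma measurable_hist_eq X h : measurable [set w : space X | hist (size h) w = h].
Proof.
elim/last_ind: h => [|h x IH].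
  by rewrite (_ : [set _ | _] = setT)//; apply/seteqP; split.
rewrite (_ : [set _ | _] = [set w : space X | hist (size h) w = h]
    `&` [set w : space X | step (size h) w = x]); last first.
  rewrite size_rcons; apply/seteqP; split => w /=; rewrite histS.
    by move/eqP; rewrite eqseq_rcons => /andP[/eqP ? /eqP ?].
  by move=> [-> ->].
by apply: measurableI => //; exact: measurable_step.
Qed.

Lemma hist_setE X n (A : pred (seq (U * Y))) :
  [set w : space X | A (hist n w)]
  = \bigcup_(t in [set` (fun t : n.-tuple (U * Y) => A t)])
      [set w | hist (size t) w = t].
Proof.
apply/seteqP; split => w /=.
  move=> Aw; have /eqP wn := size_hist n w.
  by exists (Tuple wn) => //=; rewrite size_hist.
by move=> [t /= At]; rewrite size_tuple => ->.
Qed.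

Lemma measurable_hist X n (A : pred (seq (U * Y))) :
  measurable [set w : space X | A (hist n w)].
Proof.
rewrite hist_setE; apply: fin_bigcup_measurable => [|t _]; last exact: measurable_hist_eq.
exact: finite_finset.
Qed.

Lemma prob_hist X i n (A : pred (seq (U * Y))) :
  prob X i [set w | A (hist n w)]
  = (expect y0 (policy X) (p i) n (fun h => (A h)%:R))%:E.
Proof.
rewrite hist_setE measure_fin_bigcup; first last.
- by move=> t _; exact: measurable_hist_eq.
- move=> s t _ _ [w /= []]; rewrite !size_tuple => -> st.
  exact: val_inj.
- exact: finite_finset.
rewrite expectE -(bigfs _ (r := index_enum _)) ?index_enum_uniq//; last first.
  by move=> t _; rewrite mem_index_enum.
rewrite big_mkcond -sumEFin; apply: eq_bigr => t _.
by case: ifPn => _; rewrite ?mul1r ?mul0r//; exact: step_law.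
Qed.

(** The filtration is generated by the histories, so a stopping time is a
   predicate on them, which is decreasing along extensions. *)
Definition survival X (N : space X -> option nat) alive : Prop :=
  (forall h x, alive (rcons h x) -> alive h) /\
  forall n w, alive (hist n w) <-> (forall m, N w = Some m -> (n < m)%N).

Lemma alive_take alive h k : (forall h x, alive (rcons h x) -> alive h) ->
  alive h -> alive (take k h).
Proof.
move=> aliveS; elim/last_ind: h => [|h x IH] // ah.
have [hk|kh] := ltnP (size h) k; first by rewrite take_oversize// size_rcons.
by rewrite -cats1 takel_cat//; exact: IH (aliveS _ _ ah).
Qed.

Definition stops alive h : bool :=
  ~~ alive h && ((h == [::]) || alive (take (size h).-1 h)).

Lemma stops_nil alive : stops alive [::] = ~~ alive [::].
Proof. by rewrite /stops andbT. Qed.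

Lemma stops_rcons alive h x : stops alive (rcons h x) = alive h && ~~ alive (rcons h x).
Proof.
rewrite /stops size_rcons /=.
have -> : take (size h) (rcons h x) = h by rewrite -cats1 take_size_cat.
by case: h => [|? ?]; rewrite andbC.
Qed.

(** The predicates that present the events of the filtration are arbitrary on
   histories that never occur; testing every prefix makes them monotone. *)
Lemma stopping_time_survival X (N : space X -> option nat) :
  stopping_time N -> exists alive, survival N alive.
Proof.
move=> stN; have /choice[A AN] : forall n, exists A : set (seq (U * Y)),
    [set w | exists2 m, (m <= n)%N & N w = Some m] = [set w | A (hist n w)].
  by move=> n; have [A _ <-] := stN n; exists A; rewrite setTI.
have ANP n w : A n (hist n w) <-> exists2 m, (m <= n)%N & N w = Some m.
  by have := AN n => /(congr1 (@^~ w)) /= ->.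
exists (fun h => `[< forall k, (k <= size h)%N -> ~ A k (take k h) >]); split.
  move=> h x /asboolP alive; apply/asboolP => k kh; have := alive k.
  by rewrite size_rcons -cats1 takel_cat//; apply; exact: leqW.
move=> n w; split => [/asboolP alive m Nm|Nn].
  rewrite ltnNge; apply/negP => mn; have := alive m; rewrite size_hist => /(_ mn).
  by rewrite take_hist//; apply; apply/ANP; exists m.
apply/asboolP => k; rewrite size_hist => kn; rewrite take_hist// => /ANP[m mk /Nn].
by rewrite ltnNge (leq_trans mk kn).
Qed.

Lemma stops_hist X (N : space X -> option nat) alive n w :
  survival N alive -> stops alive (hist n w) <-> N w = Some n.
Proof.
move=> [_ aliveP]; case: n => [|n].
  rewrite hist0 stops_nil -(hist0 w); split.
    move/negP => al; case Nw : (N w) => [m|]; last by case: al; apply/aliveP => m; rewrite Nw.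
    congr Some; apply/eqP; rewrite -leqn0 leqNgt; apply/negP => m0.
    by apply: al; apply/aliveP => m'; rewrite Nw => -[<-].
  by move=> N0; apply/negP => /aliveP /(_ _ N0).
rewrite histS stops_rcons -histS; split.
  move=> /andP[/aliveP al /negP al']; case Nw : (N w) => [m|]; last first.
    by case: al'; apply/aliveP => m; rewrite Nw.
  congr Some; apply/eqP; rewrite eqn_leq al// andbT leqNgt; apply/negP => m0.
  by apply: al'; apply/aliveP => m'; rewrite Nw => -[<-].
move=> Nn; apply/andP; split; first by apply/aliveP => m; rewrite Nn => -[<-].
by apply/negP => /aliveP /(_ _ Nn); rewrite ltnn.
Qed.

End Process.

Section TestLaw.
Context {R : realType} {Y U : finType} {M : nat} {p : 'I_M -> U -> Y -> Y -> R}
  {y0 : Y} (t : sequential_test p y0) (alive : pred (seq (U * Y))).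
Hypotheses (p_gt0 : forall i u yt y, 0 < p i u yt y)
  (alive_t : survival (@stop _ _ _ _ _ _ t) alive).
Local Notation E i n f := (expect y0 (policy (process t)) (p i) n f).

Lemma test_expect_ge0 i n f : (forall h, 0 <= f h) -> 0 <= E i n f.
Proof.
move=> f0; apply: expect_ge0 => //; last by move=> *; exact: ltW.
by move=> h u; have [] := policy_pmf (process t) h.
Qed.

(** The decision is taken at exactly one length of the history. *)
Lemma decision_prob i (D : pred 'I_M) :
  pr t i [set w | exists2 j, decision w = Some j & D j]
  = (\sum_(0 <= n <oo) (E i n (fun h => (stops alive h && D (rule t h))%:R))%:E)%E.
Proof.
pose A h := stops alive h && D (rule t h).
have mA n : measurable [set w : space (process t) | A (hist n w)] by exact: measurable_hist.
under eq_eseriesr => n _ do rewrite -(prob_hist _ _ _ A).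
rewrite -measure_semi_bigcup.
- congr (pr t i _); apply/seteqP; split => w /=.
    move=> [j]; rewrite /decision; case Nw : (stop w) => [n|//] /= [<-] Dj.
    by exists n => //=; rewrite /A Dj andbT; apply/(stops_hist _ _ alive_t).
  move=> [n _ /= /andP[/(stops_hist _ _ alive_t) Nw Dj]].
  by exists (rule t (hist n w)) => //; rewrite /decision Nw.
- exact: mA.
- move=> m n _ _ [w [/= /andP[/(stops_hist _ _ alive_t) Nm _]]].
  by move=> /andP[/(stops_hist _ _ alive_t) + _]; rewrite Nm => -[].
- by apply: bigcup_measurable => n _; exact: mA.
Qed.

Lemma le_decision_prob i (D : pred 'I_M) n :
  ((\sum_(k < n) E i k (fun h => (stops alive h && D (rule t h))%:R))%:E
   <= pr t i [set w | exists2 j, decision w = Some j & D j])%E.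
Proof.
rewrite decision_prob -sumEFin -(big_mkord xpredT (fun k => (E i k _)%:E)).
by apply: nneseries_lim_ge => k _ _; rewrite lee_fin; exact: test_expect_ge0.
Qed.

Lemma decision_prob_le i (D : pred 'I_M) (b : R) :
  (forall n, \sum_(k < n) E i k (fun h => (stops alive h && D (rule t h))%:R) <= b) ->
  (pr t i [set w | exists2 j, decision w = Some j & D j] <= b%:E)%E.
Proof.
move=> Eb; rewrite decision_prob; apply: lime_le.
  by apply: is_cvg_nneseries => k _ _; rewrite lee_fin; exact: test_expect_ge0.
by apply: nearW => n; rewrite sumEFin lee_fin big_mkord.
Qed.

(** The stopping time is the number of steps begun while the test is alive. *)
Lemma mean_timeE i :
  mean_time t i = (\sum_(0 <= n <oo) (E i n (fun h => (alive h)%:R))%:E)%E.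
Proof.
have aliveP := alive_t.2.
have -> : mean_time t i =
    (\int[pr t i]_w \sum_(0 <= n <oo) (\1_[set w' | alive (hist n w')] w)%:E)%E.
  apply: eq_integral => w _.
  case Nw : (stop w) => [m|] /=.
    rewrite (nneseries_split 0 m)//.
    rewrite add0n [X in (_ + X)%E]eseries0 ?adde0; last first.
      move=> k mk _; rewrite indicE memNset//= => /aliveP /(_ _ Nw).
      by rewrite ltnNge mk.
    rewrite sumEFin (eq_big_nat _ _ (F2 := fun=> 1)) => [|k /andP[_ km]].
      by rewrite sumr_const_nat subn0.
    by rewrite indicE mem_set//=; apply/aliveP => m'; rewrite Nw => -[<-].
  apply/esym/eqyP => r r0.
  apply: (@le_trans _ _ (\sum_(0 <= k < (Num.truncn r).+1) (\1_[set w' | alive (hist k w')] w)%:E)%E).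
    rewrite sumEFin lee_fin (eq_big_nat _ _ (F2 := fun=> 1)) => [|k _].
      by rewrite sumr_const_nat subn0 ltW// truncnS_gt.
    by rewrite indicE mem_set//=; apply/aliveP => m'; rewrite Nw.
  by apply: nneseries_lim_ge => k _ _; rewrite lee_fin.
rewrite integral_nneseries//.
- apply: eq_eseriesr => n _; rewrite integral_indic//; last exact: measurable_hist.
  by rewrite setIT [LHS]prob_hist.
- by move=> n; apply/measurable_EFinP; apply: measurable_indic; exact: measurable_hist.
Qed.

Lemma le_mean_time i n :
  ((\sum_(k < n) E i k (fun h => (alive h)%:R))%:E <= mean_time t i)%E.
Proof.
rewrite mean_timeE -sumEFin -(big_mkord xpredT (fun k => (E i k _)%:E)).
by apply: nneseries_lim_ge => k _ _; rewrite lee_fin; exact: test_expect_ge0.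
Qed.

Lemma mean_time_le i (b : R) :
  (forall n, \sum_(k < n) E i k (fun h => (alive h)%:R) <= b) ->
  (mean_time t i <= b%:E)%E.
Proof.
move=> Eb; rewrite mean_timeE; apply: lime_le.
  by apply: is_cvg_nneseries => k _ _; rewrite lee_fin; exact: test_expect_ge0.
by apply: nearW => n; rewrite sumEFin lee_fin big_mkord.
Qed.

End TestLaw.

(** * Positive stochastic kernels on a finite set *)

Section Kernel.
Context {R : realType} {Y : finType} (y0 : Y) (K : Y -> Y -> R) (c : R).
Hypotheses (c_gt0 : 0 < c) (c_le : forall y z, c <= K y z)
  (K_sum : forall y, \sum_z K y z = 1).

(** Subtracting the common lower bound [c] from a stochastic kernel leaves a
   kernel of row sums [1 - c * #|Y|], hence a strict l1-contraction. *)
Lemma l1_resolvent_bound (x b : Y -> R) :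
  (forall y, x y - \sum_z x z * (K z y - c) = b y) ->
  c * #|Y|%:R * \sum_y `|x y| <= \sum_y `|b y|.
Proof.
move=> xb.
have H y : `|x y| <= `|b y| + \sum_z `|x z| * (K z y - c).
  have -> : x y = b y + \sum_z x z * (K z y - c) by rewrite -xb subrK.
  apply: le_trans (ler_normD _ _) _; rewrite lerD2l.
  apply: le_trans (ler_norm_sum _ _ _) _; apply: ler_sum => z _.
  by rewrite normrM [`|K z y - c|]ger0_norm// subr_ge0.
have := ler_sum (index_enum Y) (fun y (_ : true) => H y).
rewrite big_split/= exchange_big/=.
have -> : \sum_z \sum_y `|x z| * (K z y - c) = (1 - c * #|Y|%:R) * \sum_y `|x y|.
  rewrite mulr_sumr; apply: eq_bigr => z _.
  by rewrite -mulr_sumr sumrB K_sum sumr_const -[X in _ - X]mulr_natr mulrC.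
by rewrite mulrBl mul1r; lra.
Qed.

Let n := #|Y|.

Let A : 'M[R]_n :=
  \matrix_(i, j) ((i == j)%:R - (K (enum_val i) (enum_val j) - c)).

Let mulA (v : 'rV[R]_n) (j : 'I_n) :
  (v *m A) 0 j = v 0 j - \sum_z v 0 (enum_rank z) * (K z (enum_val j) - c).
Proof.
rewrite mxE; under eq_bigr => i _ do rewrite mxE mulrBr.
rewrite sumrB; congr (_ - _).
  rewrite (bigD1 j)//= eqxx mulr1 big1 ?addr0// => i /negbTE ->.
  by rewrite mulr0.
rewrite [RHS](reindex (@enum_val Y predT))/=; last first.
  by apply: onW_bij; exact: enum_val_bij.
by apply: eq_bigr => i _; rewrite enum_valK.
Qed.

Let card_gt0 : 0 < c * #|Y|%:R.
Proof. by rewrite mulr_gt0// ltr0n; apply/card_gt0P; exists y0. Qed.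

Let A_unit : A \in unitmx.
Proof.
rewrite -row_free_unit; apply/inj_row_free => v vA.
have H y : v 0 (enum_rank y) - \sum_z v 0 (enum_rank z) * (K z y - c) = 0.
  by have := mulA v (enum_rank y); rewrite vA mxE enum_rankK => <-.
have := l1_resolvent_bound H.
rewrite [leRHS]big1 => [|y _]; last by rewrite normr0.
rewrite pmulr_rle0// => v0; apply/rowP => j; rewrite mxE; apply/eqP.
rewrite -normr_eq0 eq_le normr_ge0 andbT; apply: le_trans v0.
rewrite (bigD1 (enum_val j))//= enum_valK lerDl; exact: sumr_ge0.
Qed.

Lemma left_resolvent (b : Y -> R) :
  exists x : Y -> R, forall y, x y - \sum_z x z * (K z y - c) = b y.
Proof.
pose v := (\row_j b (enum_val j)) *m invmx A.
exists (fun y => v 0 (enum_rank y)) => y.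
have := mulA v (enum_rank y); rewrite enum_rankK => <-; rewrite mulmxKV//.
by rewrite mxE enum_rankK.
Qed.

Lemma right_resolvent (b : Y -> R) :
  exists x : Y -> R, forall y, x y - \sum_z (K y z - c) * x z = b y.
Proof.
pose v := invmx A *m (\col_j b (enum_val j)).
exists (fun y => v (enum_rank y) 0) => y.
have <- : (A *m v) (enum_rank y) 0 = b y by rewrite mulKVmx// mxE enum_rankK.
transitivity (\sum_j ((enum_rank y == j)%:R * v j 0
    - (K y (enum_val j) - c) * v j 0)); last first.
  by rewrite mxE; apply: eq_bigr => j _; rewrite -mulrBl; congr (_ * _); rewrite mxE enum_rankK.
rewrite sumrB; congr (_ - _).
  rewrite (bigD1 (enum_rank y))//= eqxx mul1r big1 ?addr0// => i.
  by rewrite eq_sym => /negbTE ->; rewrite mul0r.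
rewrite [LHS](reindex (@enum_val Y predT))/=; last first.
  by apply: onW_bij; exact: enum_val_bij.
by apply: eq_bigr => i _; rewrite enum_valK.
Qed.

(** The left resolvent applied to the constant [c] sums to 1 and has l1-norm at
   most 1, which forces it to be nonnegative. *)
Lemma stat_distP : stationary K (stat_dist K).
Proof.
suff [mu Kmu] : exists mu, stationary K mu by exact: (xgetPex _ (ex_intro _ mu Kmu)).
have [x xE] := left_resolvent (fun=> c).
have sx : \sum_y x y = 1.
  have : \sum_y (x y - \sum_z x z * (K z y - c)) = c * #|Y|%:R.
    by rewrite (eq_bigr _ (fun y _ => xE y)) sumr_const mulr_natr.
  rewrite sumrB exchange_big/=.
  under [X in _ - X]eq_bigr => z _.
    rewrite -mulr_sumr sumrB K_sum sumr_const -[c *+ _]mulr_natr; over.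
  rewrite -mulr_suml => E; have cY := card_gt0.
  by apply: (mulfI (x := c * #|Y|%:R)); [rewrite gt_eqF | lra].
have x0 y : 0 <= x y.
  have := l1_resolvent_bound xE.
  rewrite [leRHS](_ : _ = c * #|Y|%:R * \sum_y x y); last first.
    by rewrite sx mulr1 sumr_const gtr0_norm// mulr_natr.
  rewrite ler_pM2l// -subr_le0 -sumrB => S0.
  have : `|x y| - x y <= 0.
    apply: le_trans S0; rewrite (bigD1 y)//= lerDl; apply: sumr_ge0 => z _.
    by rewrite subr_ge0 ler_norm.
  by rewrite subr_le0; apply: le_trans.
exists [ffun y => x y]; split; [split|].
- by move=> y; rewrite ffunE.
- by rewrite -sx; apply: eq_bigr => y _; rewrite ffunE.
move=> y; rewrite ffunE; under eq_bigr => z _ do rewrite ffunE.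
have := xE y; under [X in _ - X]eq_bigr => z _ do rewrite mulrBr.
by rewrite sumrB -mulr_suml sx mul1r; lra.
Qed.

(** The Poisson equation turns the fluctuations of a function of the state into
   martingale increments, up to a telescoping term. The right resolvent of [g]
   solves it up to a constant, which integration identifies. *)
Lemma poisson_equation (g : Y -> R) : exists f : Y -> R, forall y,
  f y - \sum_z K y z * f z = g y - \sum_z stat_dist K z * g z.
Proof.
have [[mu0 mu1] muK] := stat_distP.
have [f fE] := right_resolvent g; exists f.
have fE' y : f y - \sum_z K y z * f z + c * \sum_z f z = g y.
  rewrite -fE mulr_sumr -addrA; congr (_ + _).
  rewrite addrC -opprB; congr (- _); rewrite -sumrB; apply: eq_bigr => z _.
  by rewrite mulrBl.
suff <- : c * \sum_z f z = \sum_z stat_dist K z * g z.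
  by move=> y; rewrite -fE' addrK.
under [RHS]eq_bigr => y _ do rewrite -fE' mulrDr mulrBr mulr_sumr.
rewrite big_split/= sumrB exchange_big/=.
under [X in _ - X + _]eq_bigr => z _.
  under eq_bigr => y _ do rewrite mulrA.
  rewrite -mulr_suml muK; over.
by rewrite subrr add0r -mulr_suml mu1 mul1r.
Qed.

(** The difference has total mass zero, and on such vectors [K] acts like its
   contraction [K - c]. *)
Lemma near_stationary (nu : Y -> R) :
  c * #|Y|%:R * \sum_y `|nu y - (\sum_z nu z) * stat_dist K y|
  <= \sum_y `|nu y - \sum_z nu z * K z y|.
Proof.
have [[mu0 mu1] muK] := stat_distP.
apply: l1_resolvent_bound => y; set m := \sum_z nu z.
under eq_bigr => z _ do rewrite mulrBl.
rewrite sumrB.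
under eq_bigr => z _ do rewrite mulrBr.
under [X in _ - (_ - X)]eq_bigr => z _ do rewrite -mulrA mulrBr mulrBr.
rewrite !sumrB -!mulr_suml -!mulr_sumr -mulr_suml muK mu1 -/m.
by ring.
Qed.

End Kernel.

(** * Information rates *)

Section FiniteBounds.
Context {R : realType} {T : finType}.

Lemma finite_lower_bound (f : T -> R) : (forall x, 0 < f x) ->
  exists2 c : R, 0 < c & forall x, c <= f x.
Proof.
move=> f0; exists (\big[Num.min/1]_x f x); last by move=> x; exact: bigmin_le.
by apply: lt_bigmin.
Qed.

Lemma finite_norm_bound (f : T -> R) : exists2 D : R, 0 <= D & forall x, `|f x| <= D.
Proof.
exists (\sum_x `|f x|) => [|x]; first exact: sumr_ge0.
by rewrite (bigD1 x)//= lerDl; exact: sumr_ge0.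
Qed.

Lemma sum_eq1 (x : T) (f : T -> R) : \sum_y (x == y)%:R * f y = f x.
Proof.
rewrite (bigD1 x)//= eqxx mul1r big1 ?addr0// => y.
by rewrite eq_sym => /negbTE ->; rewrite mul0r.
Qed.

End FiniteBounds.

Section Information.
Context {R : realType} {Y U : finType} {M : nat} (p : 'I_M -> U -> Y -> Y -> R)
  (y0 : Y).
Hypotheses (p_gt0 : forall i u yt y, 0 < p i u yt y)
  (p_pmf : forall i u yt, is_pmf (p i u yt)).
Implicit Types (i j : 'I_M) (q : Y -> U -> R) (h : seq (U * Y)).

(** The constants of the whole proof come from finiteness and positivity. *)
Lemma transition_lower_bound :
  exists2 c : R, 0 < c & forall i u yt y, c <= p i u yt y.
Proof.
have [c c0 cp] := @finite_lower_bound R ('I_M * U * Y * Y)%type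
  (fun x => p x.1.1.1 x.1.1.2 x.1.2 x.2) (fun x => p_gt0 _ _ _ _).
by exists c => // i u yt y; exact: (cp (i, u, yt, y)).
Qed.

Lemma log_ratio_bound :
  exists2 D : R, 0 <= D & forall i j u yt y, `|ln (p i u yt y / p j u yt y)| <= D.
Proof.
have [D D0 Dp] := @finite_norm_bound R ('I_M * 'I_M * U * Y * Y)%type
  (fun x => ln (p x.1.1.1.1 x.1.1.2 x.1.2 x.2 / p x.1.1.1.2 x.1.1.2 x.1.2 x.2)).
by exists D => // i j u yt y; exact: (Dp (i, j, u, yt, y)).
Qed.

Lemma kl_div_ge0 i j u yt : 0 <= kl_div (p i u yt) (p j u yt).
Proof.
rewrite -oppr_le0 -sumrN; apply: (@le_trans _ _ (\sum_y (p j u yt y - p i u yt y))).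
  apply: ler_sum => y _; have pi := p_gt0 i u yt y; have pj := p_gt0 j u yt y.
  rewrite -mulrN -lnV ?posrE ?divr_gt0// invf_div.
  have -> : p j u yt y - p i u yt y = p i u yt y * (p j u yt y / p i u yt y - 1).
    by field; rewrite gt_eqF.
  rewrite ler_pM2l//; have := @le_ln1Dx R (p j u yt y / p i u yt y - 1).
  by rewrite [1 + _]addrC subrK; apply; rewrite ltrBrDl subrr divr_gt0.
by rewrite sumrB !(p_pmf _ _ _).2 subrr.
Qed.

Lemma norm_kl_div (D : R) i j u yt :
  (forall y, `|ln (p i u yt y / p j u yt y)| <= D) ->
  `|kl_div (p i u yt) (p j u yt)| <= D.
Proof.
move=> Dp; apply: le_trans (ler_norm_sum _ _ _) _.
apply: (@le_trans _ _ (\sum_y p i u yt y * D)); last first.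
  by rewrite -mulr_suml (p_pmf i u yt).2 mul1r.
by apply: ler_sum => y _; rewrite normrM gtr0_norm// ler_pM2l.
Qed.

Lemma norm_average_le (T : finType) (f g : T -> R) D : is_pmf f ->
  (forall x, `|g x| <= D) -> `|\sum_x f x * g x| <= D.
Proof.
move=> [f0 f1] gD; apply: le_trans (ler_norm_sum _ _ _) _.
apply: (@le_trans _ _ (\sum_x f x * D)); last by rewrite -mulr_suml f1 mul1r.
by apply: ler_sum => x _; rewrite normrM ger0_norm// ler_wpM2l.
Qed.

Section MixedKernel.
Variables (i : 'I_M) (q : Y -> U -> R).
Hypothesis q_pmf : cond_pmf q.

Lemma mixed_kernel_ge (c : R) yt y : (forall u, c <= p i u yt y) ->
  c <= mixed_kernel p i q yt y.
Proof.
move=> cp; have [q0 q1] := q_pmf yt; rewrite -[c]mul1r -q1 mulr_suml.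
by apply: ler_sum => u _; exact: ler_wpM2l.
Qed.

Lemma mixed_kernel_sum yt : \sum_y mixed_kernel p i q yt y = 1.
Proof.
rewrite exchange_big/= -(q_pmf yt).2; apply: eq_bigr => u _.
by rewrite -mulr_sumr (p_pmf _ _ _).2 mulr1.
Qed.

Lemma mixed_stat_distP : stationary (mixed_kernel p i q) (stat_dist (mixed_kernel p i q)).
Proof.
have [c c0 cp] := transition_lower_bound.
apply: (stat_distP y0 c0) => [yt y|]; first exact: mixed_kernel_ge.
exact: mixed_kernel_sum.
Qed.

Lemma info_rateE j : info_rate p i j q = \sum_yt stat_dist (mixed_kernel p i q) yt *
  \sum_u q yt u * kl_div (p i u yt) (p j u yt).
Proof.
apply: eq_bigr => yt _; rewrite mulr_sumr; apply: eq_bigr => u _.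
by rewrite mulrA.
Qed.

Lemma info_rate_ge0 j : 0 <= info_rate p i j q.
Proof.
have [[mu0 _] _] := mixed_stat_distP; apply: sumr_ge0 => yt _; apply: sumr_ge0 => u _.
by rewrite mulr_ge0 ?kl_div_ge0// mulr_ge0// (q_pmf yt).1.
Qed.

Lemma info_rate_le (D : R) j :
  (forall i j u yt y, `|ln (p i u yt y / p j u yt y)| <= D) -> info_rate p i j q <= D.
Proof.
move=> Dp; rewrite info_rateE; apply: le_trans (ler_norm _) _.
have [mu_pmf _] := mixed_stat_distP.
apply: norm_average_le => // yt; apply: norm_average_le => // u.
exact: norm_kl_div.
Qed.

Lemma min_info_le j : j != i -> min_info p i q <= info_rate p i j q.
Proof.
move=> ji; apply: ge_inf; last by exists j.
by exists 0 => _ [k _ ->]; exact: info_rate_ge0.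
Qed.

Lemma min_infoP : (1 < M)%N -> exists2 j, j != i & min_info p i q = info_rate p i j q.
Proof.
move=> M1; have [j0 j0i] : exists j : 'I_M, j != i.
  pose k0 := Ordinal (ltnW M1); pose k1 := Ordinal M1.
  by case: (eqVneq k0 i) => [<-|]; [exists k1 | exists k0].
have [j ji jmin] :=
  @arg_minP _ R _ j0 (fun j => j != i) (fun j => info_rate p i j q) j0i.
exists j => //; apply/eqP; rewrite eq_le min_info_le//=.
by apply: lb_le_inf => [|_ [k ki ->]]; [exists (info_rate p i j q), j | exact: jmin].
Qed.

Lemma min_info_ge0 : (1 < M)%N -> 0 <= min_info p i q.
Proof. by move=> /min_infoP[j _ ->]; exact: info_rate_ge0. Qed.

End MixedKernel.

Lemma min_info_le_v_opt i q : (1 < M)%N -> cond_pmf q -> min_info p i q <= v_opt p i.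
Proof.
move=> M1 q_pmf; apply: ub_le_sup; last by exists q.
have [D D0 Dp] := log_ratio_bound; exists D => _ [q' q'_pmf <-].
by have [j _ ->] := min_infoP i q'_pmf M1; exact: info_rate_le.
Qed.

Lemma v_opt_ge0 i q : (1 < M)%N -> cond_pmf q -> 0 <= v_opt p i.
Proof.
move=> M1 q_pmf; apply: le_trans (min_info_le_v_opt i M1 q_pmf).
exact: min_info_ge0.
Qed.

(** The supremum in the definition of [v_opt] is attained by [q]. *)
Lemma maximizer_v_opt i q : (1 < M)%N -> is_maximizer p i q -> min_info p i q = v_opt p i.
Proof.
move=> M1 [q_pmf qmax]; apply/eqP; rewrite eq_le min_info_le_v_opt//=.
apply: sup_le_ub; first by exists (min_info p i q), q.
by move=> _ [q' q'_pmf <-]; exact: qmax.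
Qed.
End Information.

(** * The converse *)

(** The tangent inequality [expR x >= 1 + x] at [x = z - ln l]. *)
Lemma opp_le_expR_div {R : realType} (l z : R) : 0 < l -> z <= expR z / l - 1 + ln l.
Proof.
move=> l0; have := expR_ge1Dx (z - ln l); rewrite expRD expRN lnK ?posrE//; lra.
Qed.

Section Converse.
Context {R : realType} {Y U : finType} {M : nat} (p : 'I_M -> U -> Y -> Y -> R)
  (y0 : Y).
Hypotheses (M_gt1 : (1 < M)%N) (p_gt0 : forall i u yt y, 0 < p i u yt y)
  (p_pmf : forall i u yt, is_pmf (p i u yt)).
Variables (q : seq (U * Y) -> U -> R) (alive : pred (seq (U * Y)))
  (rule : seq (U * Y) -> 'I_M).
Hypotheses (q_pmf : forall h, is_pmf (q h))
  (alive_rcons : forall h x, alive (rcons h x) -> alive h).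
Implicit Types (i j : 'I_M) (f g : seq (U * Y) -> R) (h : seq (U * Y)).
Local Notation E i n f := (expect y0 q (p i) n f).
Local Notation stop h := (stops alive h).

Definition llr i j h (x : U * Y) : R :=
  ln (p i x.1 (last_obs y0 h) x.2 / p j x.1 (last_obs y0 h) x.2).

Lemma llrN i j h x : llr j i h x = - llr i j h x.
Proof. by rewrite /llr -lnV ?posrE ?divr_gt0// invf_div. Qed.

Lemma path_llrN i j h : path_sum (llr j i) h = - path_sum (llr i j) h.
Proof. by rewrite -sumrN; apply: eq_bigr => k _; exact: llrN. Qed.

Lemma expect_llr i j n f :
  E j n f = E i n (fun h => expR (path_sum (llr j i) h) * f h).
Proof.
apply: expect_tilt => h x; rewrite /llr lnK ?posrE ?divr_gt0//.
by field; rewrite gt_eqF.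
Qed.

Let q_ge0 h u : 0 <= q h u. Proof. by have [] := q_pmf h. Qed.
Let p_ge0 i u yt y : 0 <= p i u yt y. Proof. exact: ltW. Qed.
Let leE i n f g : (forall h, f h <= g h) -> E i n f <= E i n g.
Proof. by move=> fg; apply: le_expect. Qed.
Let geE0 i n f : (forall h, 0 <= f h) -> 0 <= E i n f.
Proof. by move=> f0; apply: expect_ge0. Qed.

Lemma expect_step i n g :
  E i n.+1 (fun h => (alive h)%:R * g h) + E i n.+1 (fun h => (stop h)%:R * g h)
  = E i n (fun h => (alive h)%:R * next y0 q (p i) h (fun x => g (rcons h x))).
Proof.
rewrite -expectD expectS; apply: eq_expect => h _; rewrite -nextZ; apply: eq_next => x.
rewrite -mulrDl stops_rcons; case: (boolP (alive (rcons h x))) => /= [/alive_rcons ->|_].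
  by rewrite addr0.
by rewrite andbT add0r.
Qed.

Lemma expect_start i g :
  E i 0 (fun h => (alive h)%:R * g h) + E i 0 (fun h => (stop h)%:R * g h) = g [::].
Proof. by rewrite /expect stops_nil -mulrDl; case: (alive _); rewrite /= ?addr0 ?add0r mul1r. Qed.

(** Optional stopping at the stopping time truncated at [n]: each step begun
   while alive contributes the conditional increment of [g]. *)
Lemma expect_stopped i g n :
  E i n (fun h => (alive h)%:R * g h)
    + \sum_(k < n.+1) E i k (fun h => (stop h)%:R * g h)
  = g [::] + \sum_(k < n) E i k (fun h => (alive h)%:R *
      (next y0 q (p i) h (fun x => g (rcons h x)) - g h)).
Proof.
elim: n => [|n IH]; first by rewrite big_ord1 big_ord0 addr0; exact: expect_start.
rewrite [in LHS]big_ord_recr [in RHS]big_ord_recr/= [RHS]addrA -IH.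
have -> : E i n (fun h => (alive h)%:R *
      (next y0 q (p i) h (fun x => g (rcons h x)) - g h))
    = E i n.+1 (fun h => (alive h)%:R * g h) + E i n.+1 (fun h => (stop h)%:R * g h)
      - E i n (fun h => (alive h)%:R * g h).
  by rewrite expect_step -expectB; apply: eq_expect => h _; rewrite mulrBr.
ring.
Qed.

(** Optional stopping for the constant function: no mass is lost. *)
Lemma expect_stopped1 i n :
  E i n (fun h => (alive h)%:R) + \sum_(k < n.+1) E i k (fun h => (stop h)%:R) = 1.
Proof.
have := expect_stopped i (fun=> 1) n.
rewrite [X in _ = _ + X]big1 => [|k _]; last first.
  rewrite -[RHS](expect0 y0 q (p i) k); apply: eq_expect => h _.
  by rewrite (next_cst _ _ (q_pmf h) (p_pmf i)) subrr mulr0.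
rewrite addr0 => e; rewrite -[RHS]e; congr (_ + _); last apply: eq_bigr => k _;
  by apply: eq_expect => h _; rewrite mulr1.
Qed.

(** The Kullback-Leibler information collected until stopping must cover the
   cost of separating the two laws of the decision. With [L] the stopped
   log-likelihood ratio of [i] to [j], the tangent inequality bounds [- L] by
   [expR (- L) / l - 1 + ln l] where the decision is [i], and by
   [expR (- L) - 1] elsewhere; the change of measure then turns the expectations
   of [expR (- L)] under [i] into probabilities under [j]. *)
Lemma stopped_information i j n (l : R) : 0 < l ->
  \sum_(k < n.+1) E j k (fun h => (stop h && (rule h == i))%:R) <= l ->
  - ln l * \sum_(k < n.+1) E i k (fun h => (stop h && (rule h == i))%:R) - 1
  <= \sum_(k < n) E i k (fun h => (alive h)%:R * next y0 q (p i) h (llr i j h)).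
Proof.
move=> l0 jl.
pose A h : R := (stop h && (rule h == i))%:R.
pose B h : R := (stop h && (rule h != i))%:R.
have stopAB h : (stop h)%:R = A h + B h.
  by rewrite /A /B; case: (stop h); case: (rule h == i); rewrite /= ?addr0 ?add0r.
have nextL h : next y0 q (p i) h (fun x => path_sum (llr i j) (rcons h x))
    - path_sum (llr i j) h = next y0 q (p i) h (llr i j h).
  rewrite (eq_next _ _ _ _ (path_sum_rcons (llr i j) h)).
  by rewrite nextD (next_cst _ _ (q_pmf h) (p_pmf i)) addrAC subrr add0r.
have -> : \sum_(k < n) E i k (fun h => (alive h)%:R * next y0 q (p i) h (llr i j h))
    = E i n (fun h => (alive h)%:R * path_sum (llr i j) h)
      + \sum_(k < n.+1) E i k (fun h => (stop h)%:R * path_sum (llr i j) h).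
  rewrite expect_stopped path_sum_nil add0r; apply: eq_bigr => k _.
  by apply: eq_expect => h _; rewrite nextL.
have negE f k : E i k (fun h => f h * - path_sum (llr i j) h)
   = - E i k (fun h => f h * path_sum (llr i j) h).
  by rewrite -expectN; apply: eq_expect => h _; rewrite mulrN.
have ub k f : (forall h, 0 <= f h) -> - E i k (fun h => f h * path_sum (llr i j) h)
     <= E j k f - E i k f.
  move=> f0; rewrite -negE (expect_llr i j) -expectB; apply: leE => h.
  rewrite (path_llrN i j) (_ : _ - f h = f h * (expR (- path_sum (llr i j) h) - 1)); last by ring.
  apply: ler_wpM2l => //.
  by have := expR_ge1Dx (- path_sum (llr i j) h); lra.
have ubA k : - E i k (fun h => A h * path_sum (llr i j) h)
     <= E j k A / l - (1 - ln l) * E i k A.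
  rewrite -negE (expect_llr i j) [_ / l]mulrC -expectZ -expectZ -expectB; apply: leE => h.
  rewrite (path_llrN i j).
  have -> : l^-1 * (expR (- path_sum (llr i j) h) * A h) - (1 - ln l) * A h
     = A h * (expR (- path_sum (llr i j) h) / l - 1 + ln l) by ring.
  by apply: ler_wpM2l; [rewrite ler0n | exact: opp_le_expR_div].
have ubB k : - E i k (fun h => B h * path_sum (llr i j) h) <= E j k B - E i k B.
  by apply: ub => h; rewrite ler0n.
have ubn := ub n (fun h => (alive h)%:R) (fun h => ler0n _ _).
have mass i' : E i' n (fun h => (alive h)%:R) + \sum_(k < n.+1) E i' k A
    + \sum_(k < n.+1) E i' k B = 1.
  rewrite -[RHS](expect_stopped1 i' n) -addrA -big_split/=; congr (_ + _).
  apply: eq_bigr => k _; rewrite -expectD; apply: eq_expect => h _.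
  by rewrite stopAB.
have stopE k : E i k (fun h => (stop h)%:R * path_sum (llr i j) h)
   = E i k (fun h => A h * path_sum (llr i j) h)
     + E i k (fun h => B h * path_sum (llr i j) h).
  by rewrite -expectD; apply: eq_expect => h _; rewrite stopAB mulrDl.
under [X in _ <= _ + X]eq_bigr => k _ do rewrite stopE.
rewrite big_split/=.
have SA := ler_sum (index_enum 'I_n.+1) (fun (k : 'I_n.+1) (_ : true) => ubA k).
have SB := ler_sum (index_enum 'I_n.+1) (fun (k : 'I_n.+1) (_ : true) => ubB k).
rewrite sumrB -mulr_suml -mulr_sumr in SA; rewrite sumrB in SB.
rewrite sumrN in SA; rewrite sumrN in SB.
have jl' : (\sum_(k < n.+1) E j k A) / l <= 1 by rewrite ler_pdivrMr// mul1r.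
have mi := mass i; have mj := mass j.
have jA0 : 0 <= \sum_(k < n.+1) E j k A.
  by apply: sumr_ge0 => k _; apply: geE0 => h; rewrite ler0n.
move: SA SB ubn jl' mi mj jA0; rewrite -/A.
set a1 := E i n _; set a2 := \sum_(k < n.+1) E i k A.
set a3 := E i n _; set a4 := \sum_(k < n.+1) E i k B.
set b1 := E j n _; set b2 := \sum_(k < n.+1) E j k A; set b4 := \sum_(k < n.+1) E j k B.
set b3 := b2 / l.
set c1 := \sum_(k < n.+1) E i k (fun h => A h * _).
set c2 := \sum_(k < n.+1) E i k (fun h => B h * _).
move=> SA SB ubn jl' mi mj jA0; move: SA SB; clearbody a1 a2 a3 a4 b1 b2 b3 b4 c1 c2.
lra.
Qed.

Section Occupation.
Variables (i : 'I_M) (n : nat).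

(** The occupation measure of the pairs (previous observation, control), up to
   stopping or to the horizon [n]. *)
Definition occupation (yt : Y) (u : U) : R :=
  \sum_(k < n) E i k (fun h => (alive h)%:R * ((last_obs y0 h == yt)%:R * q h u)).

Definition visits (yt : Y) : R :=
  \sum_(k < n) E i k (fun h => (alive h)%:R * (last_obs y0 h == yt)%:R).

Lemma occupation_ge0 yt u : 0 <= occupation yt u.
Proof. by apply: sumr_ge0 => k _; apply: geE0 => h; rewrite !mulr_ge0. Qed.

Lemma sum_occupation yt : \sum_u occupation yt u = visits yt.
Proof.
rewrite exchange_big/=; apply: eq_bigr => k _.
rewrite -expect_sum; apply: eq_expect => h _.
by rewrite -mulr_sumr -mulr_sumr (q_pmf h).2 mulr1.
Qed.

Lemma sum_last (f : seq (U * Y) -> R) k (F : Y -> R) :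
  E i k (fun h => f h * F (last_obs y0 h))
  = \sum_yt E i k (fun h => f h * (last_obs y0 h == yt)%:R) * F yt.
Proof.
transitivity (E i k (fun h => \sum_yt F yt * (f h * (last_obs y0 h == yt)%:R))).
  apply: eq_expect => h _; rewrite -{1}(sum_eq1 (last_obs y0 h) F) mulr_sumr.
  by apply: eq_bigr => yt _; ring.
by rewrite expect_sum; apply: eq_bigr => yt _; rewrite expectZ mulrC.
Qed.

Lemma sum_visits : \sum_yt visits yt = \sum_(k < n) E i k (fun h => (alive h)%:R).
Proof.
rewrite exchange_big/=; apply: eq_bigr => k _.
have := sum_last (fun h => (alive h)%:R) k (fun=> 1).
under [X in _ = X -> _]eq_bigr => yt _ do rewrite mulr1.
by move=> <-; apply: eq_expect => h _; rewrite mulr1.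
Qed.

(** Disintegrating the occupation measure yields a stationary control, to which
   the definition of [v_opt] applies. At a state that is never visited any law
   will do. *)
Definition mean_control (yt : Y) (u : U) : R :=
  if visits yt == 0 then q [::] u else occupation yt u / visits yt.

Lemma visits_mean_control yt u : visits yt * mean_control yt u = occupation yt u.
Proof.
rewrite /mean_control; case: eqVneq => [v0|v0]; last by rewrite mulrCA divff ?mulr1.
rewrite v0 mul0r; apply/esym/eqP; rewrite eq_le occupation_ge0 andbT -v0.
rewrite -sum_occupation (bigD1 u)//= lerDl; apply: sumr_ge0 => u' _.
exact: occupation_ge0.
Qed.

Lemma mean_control_pmf : cond_pmf mean_control.
Proof.
move=> yt; rewrite /mean_control; case: eqVneq => [v0|v0]; first exact: q_pmf.
split=> [u|]; last by rewrite -mulr_suml sum_occupation divff.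
apply: divr_ge0; first exact: occupation_ge0.
by rewrite -sum_occupation; apply: sumr_ge0 => u' _; exact: occupation_ge0.
Qed.

(** A visit of [y] is accounted for by the transition that led there; the two
   counts differ only by the first and the last observation. *)
Lemma flow_balance :
  \sum_y `|visits y - \sum_yt visits yt * mixed_kernel p i mean_control yt y| <= 2.
Proof.
pose a k y := E i k (fun h => (alive h)%:R * (last_obs y0 h == y)%:R).
pose s k y := E i k (fun h => (stop h)%:R * (last_obs y0 h == y)%:R).
have a0 k y : 0 <= a k y by apply: geE0 => h; rewrite mulr_ge0.
have s0 k y : 0 <= s k y by apply: geE0 => h; rewrite mulr_ge0.
have flow y : \sum_yt visits yt * mixed_kernel p i mean_control yt y
    = \sum_(k < n) (a k.+1 y + s k.+1 y).
  transitivity (\sum_yt \sum_u occupation yt u * p i u yt y).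
    apply: eq_bigr => yt _; rewrite mulr_sumr; apply: eq_bigr => u _.
    by rewrite mulrA visits_mean_control.
  transitivity (\sum_(k < n) E i k (fun h => (alive h)%:R *
      \sum_u q h u * p i u (last_obs y0 h) y)); last first.
    apply: eq_bigr => k _; rewrite /a /s expect_step; apply: eq_expect => h _.
    congr (_ * _); rewrite next_pair; apply: eq_bigr => u _; congr (_ * _).
    rewrite -(sum_eq1 y (p i u (last_obs y0 h))); apply: eq_bigr => y' _.
    by rewrite last_obs_rcons/= mulrC eq_sym.
  under eq_bigr => yt _ do under eq_bigr => u _ do rewrite mulr_suml.
  rewrite exchange_big/=; under eq_bigr => u _ do rewrite exchange_big/=.
  rewrite exchange_big/=; apply: eq_bigr => k _.
  under [RHS]eq_expect => h _ do rewrite mulr_sumr.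
  rewrite expect_sum; apply: eq_bigr => u _.
  under [RHS]eq_expect => h _ do rewrite mulrA.
  rewrite (sum_last (fun h => (alive h)%:R * q h u) k (fun yt => p i u yt y)).
  apply: eq_bigr => yt _; congr (_ * _); apply: eq_expect => h _.
  by ring.
have tel y : visits y - \sum_(k < n) (a k.+1 y + s k.+1 y)
    = a 0 y - a n y - \sum_(k < n) s k.+1 y.
  rewrite big_split/= /visits -/(a _ _) opprD addrA; congr (_ - _).
  rewrite -sumrB -(big_mkord xpredT (fun k => a k y - a k.+1 y)).
  by rewrite -opprB -(telescope_sumr (fun k => a k y))// -sumrN; apply: eq_bigr => k _; rewrite opprB.
apply: (@le_trans _ _ (\sum_y (a 0 y + (a n y + \sum_(k < n) s k.+1 y)))).
  apply: ler_sum => y _; rewrite flow tel.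
  have S0 : 0 <= \sum_(k < n) s k.+1 y by exact: sumr_ge0.
  have := a0 0 y; have := a0 n y; rewrite ler_norml; lra.
have sumE f k : \sum_y E i k (fun h => f h * (last_obs y0 h == y)%:R) = E i k f.
  transitivity (E i k (fun h => f h * 1)); last by apply: eq_expect => h _; rewrite mulr1.
  by rewrite (sum_last f k (fun=> 1)); apply: eq_bigr => y _; rewrite mulr1.
rewrite big_split/= big_split/= exchange_big/= /a /s !sumE.
under [X in _ + (_ + X)]eq_bigr => k _ do rewrite sumE.
have := expect_stopped1 i n; rewrite big_ord_recl/=.
have : 0 <= E i 0 (fun h => (stop h)%:R) by exact: geE0.
have : E i 0 (fun h => (alive h)%:R) <= 1 by rewrite /expect lern1 leq_b1.
rewrite /bump/=.
under eq_bigr => k _ do rewrite add1n.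
by lra.
Qed.

(** The number of visits differs from the stationary distribution of
   [mean_control], scaled by the expected duration, by a bounded amount; the rate
   of information for [mean_control] is at most [v_opt p i] against some [j]. *)
Lemma stopped_information_le (c D : R) : 0 < c -> 0 <= D ->
  (forall u yt y, c <= p i u yt y) ->
  (forall i j u yt y, `|ln (p i u yt y / p j u yt y)| <= D) ->
  exists2 j, j != i & 
  \sum_(k < n) E i k (fun h => (alive h)%:R * next y0 q (p i) h (llr i j h))
  <= v_opt p i * \sum_(k < n) E i k (fun h => (alive h)%:R) + D * (2 / (c * #|Y|%:R)).
Proof.
move=> c0 D0 cp Dp.
have [j ji jmin] := min_infoP y0 p_gt0 p_pmf i mean_control_pmf M_gt1.
exists j => //.
pose G yt := \sum_u mean_control yt u * kl_div (p i u yt) (p j u yt).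
have -> : \sum_(k < n) E i k (fun h => (alive h)%:R * next y0 q (p i) h (llr i j h))
    = \sum_yt visits yt * G yt.
  transitivity (\sum_yt \sum_u occupation yt u * kl_div (p i u yt) (p j u yt)); last first.
    apply: eq_bigr => yt _; rewrite mulr_sumr; apply: eq_bigr => u _.
    by rewrite mulrA visits_mean_control.
  under [RHS]eq_bigr => yt _ do under eq_bigr => u _ do rewrite mulr_suml.
  rewrite [RHS]exchange_big/=; under [RHS]eq_bigr => u _ do rewrite exchange_big/=.
  rewrite [RHS]exchange_big/=; apply: eq_bigr => k _.
  transitivity (E i k (fun h => \sum_u (alive h)%:R * q h u
      * kl_div (p i u (last_obs y0 h)) (p j u (last_obs y0 h)))).
    apply: eq_expect => h _; rewrite next_pair mulr_sumr; apply: eq_bigr => u _.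
    by rewrite mulrA.
  rewrite expect_sum; apply: eq_bigr => u _.
  rewrite (sum_last (fun h => (alive h)%:R * q h u) k
    (fun yt => kl_div (p i u yt) (p j u yt))).
  apply: eq_bigr => yt _; congr (_ * _); apply: eq_expect => h _.
  by ring.
set mu := stat_dist (mixed_kernel p i mean_control).
set m := \sum_(k < n) _.
have -> : \sum_yt visits yt * G yt
    = m * info_rate p i j mean_control + \sum_yt (visits yt - m * mu yt) * G yt.
  rewrite info_rateE mulr_sumr -big_split; apply: eq_bigr => yt _ /=.
  by rewrite -/mu -/(G yt); ring.
have m0 : 0 <= m by apply: sumr_ge0 => k _; apply: geE0.
apply: lerD.
  rewrite mulrC -jmin; apply: ler_wpM2r => //.
  exact: (min_info_le_v_opt y0 p_gt0 p_pmf i M_gt1 mean_control_pmf).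
have cY : 0 < c * #|Y|%:R by rewrite mulr_gt0// ltr0n; apply/card_gt0P; exists y0.
apply: (@le_trans _ _ (D * \sum_yt `|visits yt - m * mu yt|)).
  apply: le_trans (ler_norm _) _; apply: le_trans (ler_norm_sum _ _ _) _.
  rewrite mulr_sumr; apply: ler_sum => yt _; rewrite normrM mulrC.
  apply: ler_wpM2r => //; apply: norm_average_le => [|u]; first exact: mean_control_pmf.
  exact: norm_kl_div.
apply: ler_wpM2l => //; rewrite ler_pdivlMr// mulrC.
apply: le_trans flow_balance; rewrite /m -sum_visits.
apply: (near_stationary y0 c0) => [yt y|yt].
  exact: (mixed_kernel_ge mean_control_pmf).
exact: (mixed_kernel_sum p_pmf i mean_control_pmf).
Qed.

End Occupation.

End Converse.

Section ConverseTest.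
Context {R : realType} {Y U : finType} {M : nat} (p : 'I_M -> U -> Y -> Y -> R)
  (y0 : Y).
Hypotheses (M_gt1 : (1 < M)%N) (p_gt0 : forall i u yt y, 0 < p i u yt y)
  (p_pmf : forall i u yt, is_pmf (p i u yt)).
Implicit Types (t : sequential_test p y0) (i : 'I_M).

Lemma Pmax_ge0 t : (0 <= Pmax t)%E.
Proof. exact: bigmax_ge_id. Qed.

Lemma risk_ge0 t i : (0 <= risk t i)%E.
Proof. exact: bigmax_ge_id. Qed.

Lemma test_v_opt_ge0 t i : 0 <= v_opt p i.
Proof.
by apply: (@v_opt_ge0 _ _ _ _ _ y0 p_gt0 p_pmf i (fun=> policy (process t) [::])) => // yt;
  exact: policy_pmf.
Qed.

Lemma mean_time_ge0 t i : (0 <= mean_time t i)%E.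
Proof. by apply: integral_ge0 => w _; case: (stop w) => [n|] /=; rewrite ?lee_fin ?leey. Qed.

Lemma decision_setE t (j : 'I_M) :
  [set w : space (process t) | decision w = Some j]
  = [set w | exists2 k, decision w = Some k & pred1 j k].
Proof.
apply/seteqP; split => w /=; first by move=> dw; exists j => //=.
by move=> [k dk /eqP <-].
Qed.

Lemma measurable_decision t (D : pred 'I_M) :
  measurable [set w : space (process t) | exists2 j, decision w = Some j & D j].
Proof.
have [alive alive_t] := stopping_time_survival (@stop_stopping _ _ _ _ _ _ t).
pose A h := stops alive h && D (rule t h).
rewrite (_ : [set w | _] = \bigcup_n [set w : space (process t) | A (hist n w)]).
  by apply: bigcup_measurable => n _; exact: measurable_hist.
apply/seteqP; split => w /=.
  move=> [j]; rewrite /decision; case Nw : (stop w) => [n|//] /= [<-] Dj.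
  by exists n => //=; rewrite /A Dj andbT; apply/(stops_hist _ _ alive_t).
move=> [n _ /= /andP[/(stops_hist _ _ alive_t) Nw Dj]].
by exists (rule t (hist n w)) => //; rewrite /decision Nw.
Qed.

Lemma Pmax_le1 t : (Pmax t <= 1)%E.
Proof.
apply: bigmax_le => // i _; apply: probability_le1.
exact: (measurable_decision _ (fun k => k != i)).
Qed.

Lemma risk_le_Pmax t i : (risk t i <= Pmax t)%E.
Proof.
apply: bigmax_le => [|j ji]; first exact: Pmax_ge0.
apply: (@le_trans _ _ (pr t j [set w | exists2 k, decision w = Some k & k != j])%E).
  apply: le_measure; rewrite ?inE.
  - by rewrite decision_setE; exact: (measurable_decision _ (pred1 i)).
  - exact: (measurable_decision _ (fun k => k != j)).
  - by move=> w /= dw; exists i => //; rewrite eq_sym.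
exact: (le_bigmax _ (fun j => pr t j [set w | exists2 k, decision w = Some k & k != j])).
Qed.

(** Every wrong decision under [j] counts in the risk of the decision taken. *)
Lemma Pmax_le_risk t (b : R) : 0 <= b -> (forall i, risk t i <= b%:E)%E ->
  (Pmax t <= (M%:R * b)%:E)%E.
Proof.
move=> b0 tb; apply: bigmax_le => [|j _]; first by rewrite lee_fin mulr_ge0.
rewrite (_ : [set w | _] = \bigcup_(k in [set` (fun k => k != j)])
    [set w : space (process t) | decision w = Some k]); last first.
  by apply/seteqP; split => w /= [k]; exists k.
apply: (@le_trans _ _ (\sum_(k \in [set` (fun k => k != j)]) pr t j
    [set w | decision w = Some k])%E).
  rewrite measure_fin_bigcup//.
  - move=> k l _ _ [w [/= -> []]]; by [].
  - by move=> k _; rewrite decision_setE; exact: (measurable_decision _ (pred1 k)).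
rewrite -(bigfs _ (r := index_enum _)) ?index_enum_uniq//; last first.
  by move=> k _; rewrite mem_index_enum.
apply: (@le_trans _ _ (\sum_(k < M) b%:E)%E); last first.
  by rewrite sumEFin lee_fin sumr_const card_ord mulr_natl.
rewrite big_mkcond; apply: lee_sum => k _; case: ifPn => [kj|_]; last by rewrite lee_fin.
apply: le_trans (tb k).
by apply: (le_bigmax_cond _ (fun j => pr t j [set w | decision w = Some k])); rewrite eq_sym.
Qed.

(** The constant depends on the transition kernels only. The bound [l] on the risk
   is a parameter, so that arbitrarily small values handle a risk equal to 0. *)
Lemma converse_bound : exists2 C : R, 0 <= C & forall t i (l a m : R),
  0 < l -> l <= 1 -> (risk t i <= l%:E)%E -> (Pmax t <= a%:E)%E ->
  (mean_time t i <= m%:E)%E -> - ln l * (1 - a) <= v_opt p i * m + C.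
Proof.
have [c c0 cp] := transition_lower_bound p_gt0.
have [D D0 Dp] := log_ratio_bound p.
exists (D * (2 / (c * #|Y|%:R)) + 1).
  by rewrite addr_ge0// mulr_ge0// divr_ge0// mulr_ge0// ltW.
move=> t i l a m l0 l1 tl ta tm.
have [alive alive_t] := stopping_time_survival (@stop_stopping _ _ _ _ _ _ t).
have q_pmf := policy_pmf (process t); set q := policy (process t) in q_pmf.
pose E j n f := expect y0 q (p j) n f.
have v0 := test_v_opt_ge0 t i.
have alive0 n : 0 <= E i n (fun h => (alive h)%:R).
  apply: expect_ge0 => [h u|u yt y|h _]; [|exact: ltW|exact: ler0n].
  by have [] := q_pmf h.
have alive_m n : \sum_(k < n) E i k (fun h => (alive h)%:R) <= m.
  by rewrite -lee_fin; apply: le_trans tm; exact: le_mean_time.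
have alive_decr n k : (k <= n)%N ->
    E i n (fun h => (alive h)%:R) <= E i k (fun h => (alive h)%:R).
  move=> kn; rewrite /E -(expect_take y0 q_pmf (p_pmf i) _ kn).
  apply: le_expect => [h u|u yt y|h hn]; [|exact: ltW|].
    by have [] := q_pmf h.
  rewrite ler_nat; case: (boolP (alive h)) => // ah.
  by rewrite (alive_take k alive_t.1 ah).
have ln0 : 0 <= - ln l by rewrite oppr_ge0 ln_le0.
have main n : - ln l * (1 - a - E i n (fun h => (alive h)%:R)) - 1
    <= v_opt p i * m + D * (2 / (c * #|Y|%:R)).
  have [j ji jD] := stopped_information_le y0 M_gt1 p_gt0 p_pmf q_pmf alive_t.1 n c0 D0 (cp i) Dp.
  have tl' : \sum_(k < n.+1) E j k (fun h => (stops alive h && (rule t h == i))%:R) <= l.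
    rewrite -lee_fin; apply: le_trans tl.
    apply: le_trans (le_decision_prob p_gt0 alive_t j (pred1 i) n.+1) _.
    rewrite -decision_setE.
    exact: (le_bigmax_cond _ (fun j => pr t j [set w | decision w = Some i])).
  have := stopped_information p_gt0 p_pmf q_pmf alive_t.1 l0 tl'.
  move=> /le_trans /(_ jD) H.
  have ta' : \sum_(k < n.+1) E i k (fun h => (stops alive h && (rule t h != i))%:R) <= a.
    rewrite -lee_fin; apply: le_trans ta.
    apply: le_trans (le_decision_prob p_gt0 alive_t i (fun k => k != i) n.+1) _.
    exact: (le_bigmax _ (fun j => pr t j [set w | exists2 k, decision w = Some k & k != j])).
  have := expect_stopped1 y0 p_pmf q_pmf alive_t.1 i n.
  have -> : \sum_(k < n.+1) E i k (fun h => (stops alive h)%:R)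
    = \sum_(k < n.+1) E i k (fun h => (stops alive h && (rule t h == i))%:R)
    + \sum_(k < n.+1) E i k (fun h => (stops alive h && (rule t h != i))%:R).
    rewrite -big_split; apply: eq_bigr => k _ /=; rewrite /E -expectD.
    apply: eq_expect => h _.
    by case: (stops alive h); case: (rule t h == i); rewrite /= ?addr0 ?add0r.
  move=> mass; apply: (@le_trans _ _ (v_opt p i * \sum_(k < n) E i k (fun h => (alive h)%:R)
      + D * (2 / (c * #|Y|%:R)))); last by rewrite lerD2r ler_wpM2l.
  apply: le_trans H; rewrite lerD2r; apply: ler_wpM2l => //.
  by move: mass ta'; rewrite /E; lra.
apply/ler_addgt0Pr => e e0.
have m0 : 0 <= m by have := alive_m 0; rewrite big_ord0.
have [n ne] : exists n : nat, - ln l * m / e < n.+1%:R.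
  by exists (Num.truncn (- ln l * m / e)); exact: truncnS_gt.
have An : n.+1%:R * E i n (fun h => (alive h)%:R) <= m.
  apply: le_trans (alive_m n.+1); rewrite mulr_natl -[X in _ *+ X]card_ord -sumr_const.
  by apply: ler_sum => k _; apply: alive_decr; rewrite -ltnS.
have := main n; rewrite mulrBr.
suff : - ln l * E i n (fun h => (alive h)%:R) <= e by lra.
have n0 : 0 < n.+1%:R :> R by rewrite ltr0n.
rewrite -(ler_pM2l n0); rewrite ltr_pdivrMr// in ne.
apply: le_trans (ltW ne); rewrite mulrCA; exact: ler_wpM2l.
Qed.

(** The relative error in the converse for a test of maximal error
   probability [a]. At [a = 0] the conventions [ln 0 = 0] and [0^-1 = 0] give 0. *)
Definition converse_err (C a : R) : R := a + C / - ln a.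

Lemma converse_err_ge0 (C a : R) : 0 <= C -> 0 <= a -> a <= 1 -> 0 <= converse_err C a.
Proof.
by move=> C0 a0 a1; rewrite addr_ge0// divr_ge0// oppr_ge0 ln_le0.
Qed.

Lemma converse_err_small (C e : R) : 0 <= C -> 0 < e ->
  exists2 d, 0 < d <= 1/2 & forall a, 0 <= a -> a <= d -> converse_err C a <= e.
Proof.
move=> C0 e0; pose b := expR (- (2 * C / e)).
exists (Num.min (1/2) (Num.min (e / 2) b)).
  by rewrite ge_min lexx/= !lt_min expR_gt0 divr_gt0// divr_gt0.
move=> a a0; rewrite !le_min => /and3P[a1 ae ab].
suff : C / - ln a <= e / 2 by rewrite /converse_err; lra.
move: a0; rewrite le_eqVlt => /predU1P[<-|a0].
  by rewrite ln0// oppr0 invr0 mulr0 divr_ge0// ltW.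
have la : 2 * C / e <= - ln a by rewrite lerNr -ler_expR lnK ?posrE.
have la0 : 0 < - ln a by rewrite oppr_gt0 ln_lt0// a0/=; lra.
rewrite ler_pdivrMr// mulrC -ler_pdivrMr; last by rewrite divr_gt0.
by apply: le_trans la; rewrite invf_div mulrA [C * 2]mulrC.
Qed.

Lemma fine_Pmax t : (fine (Pmax t))%:E = Pmax t.
Proof.
apply: fineK; rewrite ge0_fin_numE ?Pmax_ge0//.
exact: le_lt_trans (Pmax_le1 t) (ltry _).
Qed.

Lemma oppe_lne_ge0 (x : \bar R) : (0 <= x <= 1)%E -> (0 <= - lne x)%E.
Proof. by move=> /andP[x0 x1]; rewrite oppe_ge0 lne_le0. Qed.

Lemma le_oppe_lne (x y : \bar R) : (0 <= x)%E -> (x <= y)%E -> (- lne y <= - lne x)%E.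
Proof.
move=> x0 xy; rewrite leeN2 lee_lne// in_itv/= leey andbT//.
exact: le_trans xy.
Qed.

Lemma inve_v_opt_ge0 t i : (0 <= ((v_opt p i)%:E)^-1)%E.
Proof. by rewrite inve_ge0 lee_fin (test_v_opt_ge0 t i). Qed.

(** The converse for a single test. It includes the case where [v_opt p i]
   vanishes, its inverse being infinite: then the mean time is infinite too. *)
Lemma converse_test : exists2 C : R, 0 <= C & forall t i,
  fine (Pmax t) < 1 -> converse_err C (fine (Pmax t)) < 1 ->
  (- lne (risk t i) / (v_opt p i)%:E * (1 - converse_err C (fine (Pmax t)))%:E
     <= mean_time t i)%E.
Proof.
have [C C0 HC] := converse_bound; exists C => // t i.
have Pa := fine_Pmax t; set a := fine (Pmax t) in Pa *.
have a0 : 0 <= a by rewrite -lee_fin Pa Pmax_ge0.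
move=> a1 err1; have v0 := test_v_opt_ge0 t i; have := mean_time_ge0 t i.
case tm : (mean_time t i) => [m| |//]; last by move=> _; exact: leey.
rewrite lee_fin => m0.
have bound l : 0 < l -> l <= 1 -> (risk t i <= l%:E)%E -> - ln l * (1 - a) <= v_opt p i * m + C.
  by move=> l0 l1 tl; apply: (HC t) => //; rewrite ?tm// -Pa.
have vm0 : 0 <= v_opt p i * m by rewrite mulr_ge0.
have R_le := risk_le_Pmax t i; rewrite -Pa in R_le.
have := risk_ge0 t i; case tr : (risk t i) => [r| |//]; last by rewrite tr in R_le.
rewrite lee_fin le_eqVlt => /predU1P[r0|r0].
  exfalso; pose x := (v_opt p i * m + C + 1) / (1 - a).
  have x0 : 0 <= x by rewrite divr_ge0//; lra.
  have x1 : expR (- x) <= 1 by rewrite -expR0 ler_expR oppr_le0.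
  have := bound (expR (- x)) (expR_gt0 _) x1.
  rewrite expRK opprK tr -r0 lee_fin => /(_ (expR_ge0 _)).
  rewrite /x divfK; first lra.
  by rewrite gt_eqF// subr_gt0.
rewrite tr lee_fin in R_le.
have r1 : r <= 1 by apply: le_trans R_le _; exact: ltW.
have := bound r r0 r1; rewrite tr => /(_ (lexx _)) br.
have ar : - ln a <= - ln r by rewrite lerN2 ler_ln ?posrE// (lt_le_trans r0).
have la : 0 < - ln a by rewrite oppr_gt0 ln_lt0// a1 (lt_le_trans r0).
have Cr : C <= C / - ln a * - ln r.
  rewrite -{1}(divfK (lt0r_neq0 la) C); apply: ler_wpM2l => //.
  by rewrite divr_ge0// ltW.
have key : - ln r * (1 - converse_err C a) <= v_opt p i * m.
  by rewrite /converse_err; move: br Cr; set z := C / _; set y := - ln r; lra.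
rewrite lne_EFin//; have [v_eq0|v_neq0] := eqVneq (v_opt p i) 0.
  exfalso; move: key; rewrite v_eq0 mul0r leNgt mulr_gt0//; last by rewrite subr_gt0.
  exact: lt_le_trans ar.
rewrite inver (negbTE v_neq0) -EFinN -!EFinM lee_fin.
rewrite mulrAC ler_pdivrMr; last by rewrite lt_neqAle eq_sym v_neq0.
by rewrite [m * _]mulrC.
Qed.

Lemma converse (t : nat -> sequential_test p y0) :
  Pmax (t n) @[n --> \oo] --> (0 : \bar R) ->
  forall i : 'I_M, exists e1 e2 : nat -> R,
    [/\ e1 n @[n --> \oo] --> (0 : R),
        e2 n @[n --> \oo] --> (0 : R) &
        \forall n \near \oo,
          (- lne (risk (t n) i) / (v_opt p i)%:E * (1 + e1 n)%:E
             <= mean_time (t n) i)%E /\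
          (- lne (Pmax (t n)) / (v_opt p i)%:E * (1 + e2 n)%:E
             <= - lne (risk (t n) i) / (v_opt p i)%:E * (1 + e1 n)%:E)%E].
Proof.
move=> t0 i; have [C C0 HC] := converse_test.
pose a n := fine (Pmax (t n)).
have a0 n : 0 <= a n by rewrite -lee_fin fine_Pmax Pmax_ge0.
have a_cvg : a n @[n --> \oo] --> (0 : R) by apply: fine_cvg t0.
have small d : 0 < d -> \forall n \near \oo, a n <= d.
  move=> d0; near=> n; rewrite -[a n]ger0_norm// -[a n]subr0 distrC; near: n.
  exact: (cvgr_dist_le _ _ a_cvg).
have err_cvg : - converse_err C (a n) @[n --> \oo] --> (0 : R).
  rewrite -oppr0; apply: cvgN; apply/cvgrPdist_le => e e0.
  have [d /andP[d0 d1] Hd] := converse_err_small C0 e0.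
  near=> n; have an : a n <= d by near: n; exact: small.
  rewrite sub0r normrN ger0_norm; first exact: Hd.
  by apply: converse_err_ge0 => //; lra.
exists (fun n => - converse_err C (a n)), (fun n => - converse_err C (a n)); split => //.
have half : 0 < (1/2 : R) by [].
have [d /andP[d0 d1] Hd] := converse_err_small C0 half.
near=> n; have an : a n <= d by near: n; exact: small.
have err1 : converse_err C (a n) < 1 by have := Hd _ (a0 n) an; lra.
split; first by apply: HC; rewrite -/(a n)//; lra.
apply: lee_wpmul2r; first by rewrite lee_fin; lra.
apply: lee_wpmul2r; first exact: inve_v_opt_ge0 (t n) i.
by apply: le_oppe_lne; [exact: risk_ge0 | exact: risk_le_Pmax].
Unshelve. all: by end_near. Qed.

End ConverseTest.

(** * The threshold test: error probabilities *)

Section StarStopping.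
Context {R : realType} {Y U : finType} {M : nat} {p : 'I_M -> U -> Y -> Y -> R}
  {y0 : Y}.
Variables (X : controlled_process p y0) (mle : seq (U * Y) -> 'I_M) (T : R).
Hypotheses (p_gt0 : forall i u yt y, 0 < p i u yt y) (T_gt0 : 0 < T).
Implicit Types (i j : 'I_M) (h : seq (U * Y)).
Local Notation E i n f := (expect y0 (policy X) (p i) n f).
Local Notation J i h := (joint_pmf p y0 (policy X) i h).

Definition star_alive h : bool :=
  all (fun k => ~~ star_stop_at X mle T (take k h)) (iota 0 (size h).+1).

Lemma star_aliveP h :
  reflect (forall k, (k <= size h)%N -> ~~ star_stop_at X mle T (take k h)) (star_alive h).
Proof.
apply: (iffP allP) => H k; last by rewrite mem_iota => /andP[_ kh]; apply: H.
by move=> kh; apply: H; rewrite mem_iota.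
Qed.

Lemma star_survival : survival (@star_time _ _ _ _ _ _ X mle T) star_alive.
Proof.
split=> [h x /star_aliveP H|n w].
  apply/star_aliveP => k kh; have := H k; rewrite size_rcons -cats1 takel_cat//.
  by apply; exact: leqW.
split=> [/star_aliveP H m|H].
  rewrite /star_time; case: pselect => // ex [<-]; case: ex_minnP => m' sm' _.
  rewrite ltnNge; apply/negP => m'n; have := H m'; rewrite size_hist => /(_ m'n).
  by rewrite take_hist// sm'.
apply/star_aliveP => k; rewrite size_hist => kn; rewrite take_hist//; apply/negP => sk.
move: H; rewrite /star_time; case: pselect => [ex|[]]; last by exists k.
case: ex_minnP => m sm /(_ _ sk) mk /(_ _ erefl).
by rewrite ltnNge (leq_trans mk kn).
Qed.

Lemma stops_star_stop_at h : stops star_alive h -> star_stop_at X mle T h.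
Proof.
move=> /andP[/star_aliveP/existsNP[k /not_implyP[kh /negP/negPn sk]]].
have [h0|h0] /= := eqVneq h [::].
  by move: sk; rewrite h0 => + _; case: (k).
move=> /star_aliveP H; move: kh; rewrite leq_eqVlt => /predU1P[kh|kh].
  by move: sk; rewrite kh take_size.
have kh' : (k <= (size h).-1)%N by rewrite -ltnS prednK// (leq_ltn_trans _ kh).
have := H k; rewrite size_takel ?leq_pred// => /(_ kh').
by rewrite take_takel// sk.
Qed.

(** The test on a quotient is sound although its denominator may vanish: the
   quotient is then 0 by convention, which does not exceed [T]. *)
Lemma star_stop_at_lt j h : j != mle h -> star_stop_at X mle T h ->
  T * J j h < J (mle h) h.
Proof.
move=> jh /andP[_]; set m := \big[_/_]_(_ < _ | _) _ => Tm.
have jm : J j h <= m by exact: (le_bigmax_cond _ (fun j => J j h)).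
have m0 : 0 < m.
  rewrite lt_neqAle bigmax_ge_id andbT eq_sym; apply: contraL Tm => /eqP ->.
  by rewrite invr0 mulr0 -leNgt ltW.
rewrite ltr_pdivlMr// in Tm; apply: le_lt_trans Tm.
by rewrite ler_wpM2l// ltW.
Qed.

(** Where the test declares [i], the likelihood of [i] is [T] times that of [j]. *)
Lemma expect_false_decision i j k : i != j ->
  E j k (fun h => (stops star_alive h && (mle h == i))%:R)
  <= T^-1 * E i k (fun h => (stops star_alive h && (mle h == i))%:R).
Proof.
move=> ij; rewrite !expectE mulr_sumr; apply: ler_sum => t _.
case: (boolP (_ && _)) => [/andP[st /eqP ti]|_]; last by rewrite !mul0r mulr0.
rewrite !mul1r -[leLHS](mulKf (lt0r_neq0 T_gt0)); apply: ler_wpM2l.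
  by rewrite invr_ge0 ltW.
rewrite -ti; apply/ltW/star_stop_at_lt; last exact: stops_star_stop_at.
by rewrite ti eq_sym.
Qed.

Lemma star_Pmax : (0 < M)%N -> (Pmax (star_test X mle T) <= ((M%:R - 1) / T)%:E)%E.
Proof.
move=> M0; have b0 : 0 <= (M%:R - 1) / T :> R.
  by apply: divr_ge0; [rewrite subr_ge0 ler1n | exact: ltW].
apply: bigmax_le => [|j _]; first by rewrite lee_fin.
apply: (@decision_prob_le _ _ _ _ _ _ (star_test X mle T) _ p_gt0 star_survival j (fun k => k != j)) => n /=.
have decE k : E j k (fun h => (stops star_alive h && (mle h != j))%:R)
    = \sum_(i < M | i != j) E j k (fun h => (stops star_alive h && (mle h == i))%:R).
  rewrite -expect_sum; apply: eq_expect => h _.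
  case: (stops _ h) => /=; last by rewrite big1.
  case: (boolP (mle h != j)) => mj /=.
    rewrite (bigD1 (mle h))//= eqxx big1 ?addr0// => i /andP[_ im].
    by rewrite eq_sym (negbTE im).
  by rewrite big1// => i; move: mj => /negPn/eqP -> /negbTE; rewrite eq_sym => ->.
under eq_bigr => k _ do rewrite decE.
rewrite exchange_big/=.
apply: (@le_trans _ _ (\sum_(i < M | i != j) T^-1)); last first.
  have -> : M%:R - 1 = M.-1%:R :> R.
    by case: (M) M0 => // m _; rewrite -natr1 addrK.
  by rewrite sumr_const cardC1 card_ord -[leLHS]mulr_natr mulrC.
apply: ler_sum => i ij; rewrite -[leRHS]mulr1.
apply: (@le_trans _ _ (T^-1 * \sum_(k < n)
    E i k (fun h => (stops star_alive h && (mle h == i))%:R))).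
  by rewrite mulr_sumr; apply: ler_sum => k _; exact: expect_false_decision.
apply: ler_wpM2l; first by rewrite invr_ge0 ltW.
rewrite -lee_fin.
apply: le_trans (le_decision_prob (t := star_test X mle T) p_gt0 star_survival i (pred1 i) n) _.
by apply: probability_le1; exact: (measurable_decision _ (pred1 i)).
Qed.

End StarStopping.

(** * Exploration makes the maximum likelihood estimate reliable *)

Section Bhattacharyya.
Context {R : realType} {Y U : finType} {M : nat} (p : 'I_M -> U -> Y -> Y -> R)
  (y0 : Y).
Hypotheses (p_gt0 : forall i u yt y, 0 < p i u yt y)
  (p_pmf : forall i u yt, is_pmf (p i u yt)).
Implicit Types (i j : 'I_M) (h : seq (U * Y)) (q : seq (U * Y) -> U -> R).

Lemma joint_pmf_llr i j q h :
  joint_pmf p y0 q j h = joint_pmf p y0 q i h * expR (path_sum (llr p y0 j i) h).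
Proof.
elim/last_ind: h => [|h x IH]; first by rewrite !joint_pmf_nil path_sum_nil expR0 mulr1.
rewrite !joint_pmf_rcons path_sum_rcons expRD IH /llr lnK ?posrE ?divr_gt0//.
by field; rewrite gt_eqF.
Qed.

(** The geometric mean of the transitions under [i] and [j]. *)
Definition geo i j u yt y : R :=
  p i u yt y * expR (ln (p j u yt y / p i u yt y) / 2).

Lemma geo_gt0 i j u yt y : 0 < geo i j u yt y.
Proof. by rewrite mulr_gt0// expR_gt0. Qed.

(** The deficit in the inequality between the arithmetic and geometric means is
   a square, positive as soon as the two transitions differ. *)
Lemma geo_amgm i j u yt y :
  (p i u yt y + p j u yt y) / 2 - geo i j u yt y
  = p i u yt y / 2 * (expR (ln (p j u yt y / p i u yt y) / 2) - 1) ^+ 2.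
Proof.
have pi := p_gt0 i u yt y; have pj := p_gt0 j u yt y.
rewrite /geo; set e := expR _.
have e2 : e ^+ 2 = p j u yt y / p i u yt y.
  by rewrite -expRM_natl mulrC divfK ?pnatr_eq0// lnK ?posrE ?divr_gt0.
have -> : p j u yt y = p i u yt y * e ^+ 2.
  by rewrite e2 mulrC divfK// gt_eqF.
by field.
Qed.

Definition geo_gap i j u yt : R := 1 - \sum_y geo i j u yt y.

Lemma geo_gapE i j u yt : geo_gap i j u yt =
  \sum_y p i u yt y / 2 * (expR (ln (p j u yt y / p i u yt y) / 2) - 1) ^+ 2.
Proof.
under [RHS]eq_bigr => y _ do rewrite -geo_amgm.
rewrite sumrB -mulr_suml big_split/= !(p_pmf _ _ _).2 /geo_gap.
by lra.
Qed.

Lemma geo_gap_ge0 i j u yt : 0 <= geo_gap i j u yt.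
Proof.
rewrite geo_gapE; apply: sumr_ge0 => y _.
by rewrite mulr_ge0 ?sqr_ge0// divr_ge0// ltW.
Qed.

Lemma geo_gap_gt0 i j u yt y : p i u yt y != p j u yt y -> 0 < geo_gap i j u yt.
Proof.
move=> pij; rewrite geo_gapE (bigD1 y)//=; apply: ltr_wpDr.
  by apply: sumr_ge0 => z _; rewrite mulr_ge0 ?sqr_ge0// divr_ge0// ltW.
rewrite mulr_gt0// ?divr_gt0// lt_neqAle sqr_ge0 andbT eq_sym sqrf_eq0 subr_eq0.
apply: contra pij => /eqP e1.
have /eqP : ln (p j u yt y / p i u yt y) / 2 = 0 by apply: expR_inj; rewrite expR0.
rewrite mulf_eq0 invr_eq0 pnatr_eq0 orbF ln_eq0 ?divr_gt0// => /eqP e.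
by rewrite (divr1_eq e).
Qed.

(** The Bhattacharyya coefficient of the laws of the first [n] steps under [i]
   and [j]. *)
Definition affinity i j q n : R := expect y0 q (geo i j) n (fun=> 1).

Section Affinity.
Variables (i j : 'I_M) (q : seq (U * Y) -> U -> R).
Hypothesis q_pmf : forall h, is_pmf (q h).

Let q_ge0 h u : 0 <= q h u. Proof. by have [] := q_pmf h. Qed.
Let geo_ge0 u yt y : 0 <= geo i j u yt y. Proof. exact/ltW/geo_gt0. Qed.

Lemma next_geo h : next y0 q (geo i j) h (fun=> 1)
  = 1 - \sum_u q h u * geo_gap i j u (last_obs y0 h).
Proof.
rewrite next_pair -{2}(q_pmf h).2 -sumrB; apply: eq_bigr => u _.
by under eq_bigr => y _ do rewrite mulr1; rewrite /geo_gap mulrBr mulr1 opprB addrCA subrr addr0.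
Qed.

Lemma affinityS n : affinity i j q n.+1 = affinity i j q n
  - expect y0 q (geo i j) n (fun h => \sum_u q h u * geo_gap i j u (last_obs y0 h)).
Proof.
by rewrite /affinity expectS -expectB; apply: eq_expect => h _; exact: next_geo.
Qed.

Lemma gap_ge0 h : 0 <= \sum_u q h u * geo_gap i j u (last_obs y0 h).
Proof. by apply: sumr_ge0 => u _; rewrite mulr_ge0// geo_gap_ge0. Qed.

Lemma affinity_decr n : affinity i j q n.+1 <= affinity i j q n.
Proof.
by rewrite affinityS lerBlDr lerDl; apply: expect_ge0 => // h _; exact: gap_ge0.
Qed.

Lemma affinity_ge0 n : 0 <= affinity i j q n.
Proof. by apply: expect_ge0. Qed.

Lemma affinity_le1 n : affinity i j q n <= 1.
Proof.
by elim: n => [//|n]; apply: le_trans; exact: affinity_decr.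
Qed.

(** Some control separates [i] from [j] only in some states. So two steps are
   needed: the first, whatever its control, gives each state a weight at least
   [c]; the second tries all the controls. *)
Lemma affinity_explore c n : 0 <= c -> (forall u yt y, c <= geo i j u yt y) ->
  (forall h u, size h = n.+1 -> q h u = #|U|%:R^-1) ->
  affinity i j q n.+2
  <= (1 - c * \sum_y \sum_u #|U|%:R^-1 * geo_gap i j u y) * affinity i j q n.+1.
Proof.
move=> c0 cg qU; rewrite affinityS mulrBl mul1r lerD2l lerN2.
set G := \sum_y _.
have G0 : 0 <= G.
  by apply: sumr_ge0 => y _; apply: sumr_ge0 => u _; rewrite mulr_ge0 ?geo_gap_ge0 ?invr_ge0.
apply: (@le_trans _ _ (c * G * affinity i j q n)).
  by rewrite ler_wpM2l ?affinity_decr// mulr_ge0.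
rewrite /affinity -expectZ expectS; apply: le_expect => // h hn; rewrite mulr1.
rewrite next_pair; apply: (@le_trans _ _ (\sum_u q h u * (c * G))).
  by rewrite -mulr_suml (q_pmf h).2 mul1r.
apply: ler_sum => u _; apply: ler_wpM2l => //; rewrite mulr_sumr.
apply: ler_sum => y _; rewrite last_obs_rcons/=.
under [X in _ <= _ * X]eq_bigr => u' _ do rewrite qU ?size_rcons ?hn//.
apply: ler_wpM2r => //.
by apply: sumr_ge0 => u' _; rewrite mulr_ge0 ?geo_gap_ge0 ?invr_ge0.
Qed.

(** Where [j] looks at least as likely as [i], the square root of its likelihood
   ratio is at least 1. *)
Lemma expect_mistaken n : expect y0 q (p i) n
    (fun h => (joint_pmf p y0 q i h <= joint_pmf p y0 q j h)%R%:R)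
  <= affinity i j q n.
Proof.
rewrite /affinity (@expect_tilt _ _ _ y0 q (p i) (geo i j) (fun h x => llr p y0 j i h x / 2))//.
apply: (@le_expect_support _ _ _ _ y0 p q i n _ _ q_ge0 (p_gt0 i)) => h hn J0; rewrite mulr1 (joint_pmf_llr i j).
have -> : path_sum (fun h x => llr p y0 j i h x / 2) h = path_sum (llr p y0 j i) h / 2.
  by rewrite /path_sum mulr_suml.
case: (boolP (joint_pmf _ _ _ _ _ <= _)) => [|_]; last exact: expR_ge0.
rewrite -{1}[joint_pmf _ _ _ _ _]mulr1 ler_pM2l// -expR0 ler_expR => le0.
by rewrite ler_expR divr_ge0.
Qed.

End Affinity.

(** Uniformity over the pairs of distinguishable hypotheses lets one bound on
   [a] serve all of them. *)
Lemma exploration_rate : exists2 rho : R, 0 < rho < 1 &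
  forall i j u yt y, p i u yt y != p j u yt y -> forall q n,
  (forall h, is_pmf (q h)) -> (forall h v, size h = n.+1 -> q h v = #|U|%:R^-1) ->
  affinity i j q n.+2 <= rho * affinity i j q n.+1.
Proof.
have [c c0 cg] := @finite_lower_bound R ('I_M * 'I_M * U * Y * Y)%type
  (fun x => geo x.1.1.1.1 x.1.1.1.2 x.1.1.2 x.1.2 x.2) (fun x => geo_gt0 _ _ _ _ _).
pose G i j := c * \sum_y \sum_u #|U|%:R^-1 * geo_gap i j u y.
have GP (x : 'I_M * 'I_M) : 0 < if 0 < G x.1 x.2 then G x.1 x.2 else 1 by case: ifP.
have [k k0 kG] := finite_lower_bound GP.
exists (1 - Num.min k (1/2)).
  have : 0 < Num.min k (1/2) by rewrite lt_min k0/=; lra.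
  have : Num.min k (1/2) <= 1/2 by rewrite ge_min lexx orbT.
  lra.
move=> i j u yt y pij q n q_pmf qU.
apply: le_trans (affinity_explore q_pmf (ltW c0) _ qU) _.
  by move=> u' yt' y'; exact: (cg (i, j, u', yt', y')).
apply: ler_wpM2r; first exact: affinity_ge0.
rewrite lerD2l lerN2 -/(G i j).
have U0 : 0 < #|U|%:R^-1 :> R by rewrite invr_gt0 ltr0n; apply/card_gt0P; exists u.
have G0 : 0 < G i j.
  rewrite mulr_gt0// (bigD1 yt)//= ltr_wpDr//.
    apply: sumr_ge0 => y' _; apply: sumr_ge0 => u' _.
    by rewrite mulr_ge0 ?geo_gap_ge0// ltW.
  rewrite (bigD1 u)//= ltr_wpDr//.
    by apply: sumr_ge0 => u' _; rewrite mulr_ge0 ?geo_gap_ge0// ltW.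
  by rewrite mulr_gt0// (geo_gap_gt0 pij).
have := kG (i, j); rewrite /= G0 => kG'.
by rewrite ge_min kG'.
Qed.

End Bhattacharyya.

(** * The exploration times grow geometrically *)

Section ExplorationTimes.
Context {R : realType} (a : R).
Hypothesis a_gt1 : 1 < a.

Definition tau (l : nat) : nat := `|Num.ceil (a ^+ l)|%N.

Let apow_gt0 l : 0 < a ^+ l.
Proof. by rewrite exprn_gt0// (lt_trans ltr01). Qed.

Let tauZ l : (tau l)%:Z = Num.ceil (a ^+ l).
Proof. by rewrite /tau gez0_abs// ltW// ceil_gt0. Qed.

Lemma tau_ge l : a ^+ l <= (tau l)%:R.
Proof. by rewrite -[_%:R]/((tau l)%:Z%:~R) tauZ ceil_ge. Qed.

Lemma tau_lt l : (tau l)%:R < a ^+ l + 1.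
Proof.
have := ceilB1_lt (a ^+ l); rewrite -tauZ intrB -[_%:~R]/((tau l)%:R : R).
by rewrite ltrBlDr.
Qed.

Lemma tau_le l n : a ^+ l <= n%:R -> (tau l <= n)%N.
Proof. by rewrite -lez_nat tauZ ceil_le_int. Qed.

Lemma explorationP k : exploration a k <-> exists l, k = tau l.
Proof.
split=> -[l kl]; exists l; last by rewrite kl tauZ.
by apply/eqP; rewrite -eqz_nat kl tauZ.
Qed.

Lemma bernoulli (b : R) n : 0 <= b -> 1 + n%:R * b <= (1 + b) ^+ n.
Proof.
move=> b0; elim: n => [|n IH]; first by rewrite mul0r addr0.
rewrite exprS; apply: (@le_trans _ _ ((1 + b) * (1 + n%:R * b))).
  have : 0 <= n%:R * b * b by rewrite !mulr_ge0.
  by rewrite -natr1; lra.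
by apply: ler_wpM2l => //; lra.
Qed.

Lemma pow_unbounded (x : R) : exists l, x < a ^+ l.
Proof.
have b0 : 0 < a - 1 by rewrite subr_gt0.
exists (Num.truncn (x / (a - 1))).+1.
have := bernoulli (Num.truncn (x / (a - 1))).+1 (ltW b0).
rewrite [1 + (a - 1)]addrC subrK; apply: lt_le_trans.
have : x < (Num.truncn (x / (a - 1))).+1%:R * (a - 1).
  by rewrite -ltr_pdivrMr// truncnS_gt.
by lra.
Qed.

(** There are about [ln n / ln a] exploration times up to [n], so the product of
   the factors [rho] is a negative power of [n], whose exponent exceeds any bound
   for [a] close to 1. The third power makes a sum of up to [n] such terms
   summable in [n]. *)
Lemma exploration_decay (rho : R) (Z : nat -> R) : 0 < rho -> a ^+ 3 * rho <= 1 ->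
  (forall n, 0 <= Z n <= 1) -> (forall n, Z n.+1 <= Z n) ->
  (forall n, exploration a n.+2 -> Z n.+2 <= rho * Z n.+1) ->
  exists2 C : R, 0 <= C & forall n, Z n * n%:R ^+ 3 <= C.
Proof.
move=> rho0 arho Z01 Zdecr Zrho.
have Zmono m n : (m <= n)%N -> Z n <= Z m.
  move=> /subnK <-; elim: (n - m)%N => [|d IH]; first by rewrite add0n.
  by rewrite addSn; exact: le_trans IH.
have a0 : 0 < a by exact: lt_trans a_gt1.
have [l0 al0] := pow_unbounded (a - 1)^-1.
have gap l : (l0 <= l)%N -> (tau l < tau l.+1)%N.
  move=> l0l; rewrite -(ltr_nat R); apply: lt_le_trans (tau_lt l) _.
  apply: le_trans (tau_ge _); rewrite exprS -lerBrDl -{2}[a ^+ l]mul1r -mulrBl.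
  have : (a - 1)^-1 <= a ^+ l.
    by apply: (le_trans (ltW al0)); rewrite ler_eXn2l.
  by rewrite -ler_pdivrMl ?subr_gt0// mulr1.
have tau0 l : (0 < tau l)%N.
  by rewrite -(ltr_nat R); apply: lt_le_trans (tau_ge l).
have Zs s : Z (tau (l0 + s)) <= rho ^+ s.
  elim: s => [|s IH]; first by have /andP[] := Z01 (tau (l0 + 0)).
  have g := gap _ (leq_addr s l0); rewrite addnS exprS.
  have ex : exploration a (tau (l0 + s).+1) by apply/explorationP; exists (l0 + s).+1.
  case: (tau (l0 + s).+1) g ex => [|[|k]] g ex //.
    by have := leq_trans (tau0 _) g.
  apply: le_trans (Zrho k ex) _; apply: ler_wpM2l; first exact: ltW.
  by apply: le_trans IH; apply: Zmono.
exists (a ^+ (3 * l0.+1)) => [|n]; first by rewrite exprn_ge0// ltW.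
have [Z0 Z1] := andP (Z01 n).
have [nl0|l0n] := ltP n%:R (a ^+ l0).
  rewrite -[leRHS]mul1r; apply: ler_pM => //.
  rewrite mulnC exprM lerXn2r ?nnegrE// ?exprn_ge0// ?ltW//.
  by apply: (lt_le_trans nl0); rewrite ler_eXn2l.
have ex := pow_unbounded n%:R; case: (ex_minnP ex) => m nm mmin.
have l0m : (l0 < m)%N.
  by rewrite -(ltr_eXn2l a_gt1); exact: le_lt_trans nm.
have [s ms] : exists s, m = (l0 + s).+1.
  by exists (m - l0.+1)%N; rewrite -addSn subnKC.
have ns : a ^+ (l0 + s) <= n%:R.
  by rewrite leNgt; apply/negP => /mmin; rewrite ms ltnn.
have Zn : Z n <= rho ^+ s by apply: le_trans (Zs s); exact/Zmono/tau_le.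
apply: (@le_trans _ _ (rho ^+ s * a ^+ (3 * m))).
  apply: ler_pM => //.
  by rewrite mulnC exprM lerXn2r ?nnegrE// ?exprn_ge0// ltW.
have -> : (3 * m = 3 * l0.+1 + 3 * s)%N by rewrite ms -addSn mulnDr.
rewrite exprD mulrCA -[leRHS]mulr1; apply: ler_wpM2l; first by rewrite exprn_ge0// ltW.
rewrite exprM mulrC -exprMn exprn_ile1//.
by rewrite mulr_ge0// ?exprn_ge0// ltW.
Qed.

(** Any [l] such that [n < a ^+ l] bounds the number of exploration times up to
   [n]; by the square of Bernoulli's inequality, [l] can be a small multiple of
   [n]. *)
Lemma exploration_count (e : R) : 0 < e -> exists2 C : R, 0 <= C & forall n,
  \sum_(k < n) `[< exploration a k.+1 >]%:R <= e * n%:R + C.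
Proof.
move=> e0; pose b := a - 1; have b0 : 0 < b by rewrite subr_gt0.
pose K := (Num.truncn (1 / (2 * b ^+ 2 * e))).+2.
have KE : K%:R - 1 = (Num.truncn (1 / (2 * b ^+ 2 * e))).+1%:R :> R.
  by rewrite /K -natr1 addrK.
have Kb : 1 <= 2 * b ^+ 2 * e * (K%:R - 1).
  have x0 : 0 < 2 * b ^+ 2 * e by rewrite !mulr_gt0// exprn_gt0.
  by rewrite KE mulrC -ler_pdivrMr// ltW// truncnS_gt.
exists (2 * K%:R) => [|n]; first by rewrite mulr_ge0.
pose L := (Num.truncn (e * n%:R / 2) + K)%N.
have en0 : 0 <= e * n%:R / 2 by rewrite divr_ge0// mulr_ge0// ltW.
have [Lle Llt] := andP (truncn_itv en0).
have nL : n%:R < a ^+ (2 * L).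
  have Lb := bernoulli L (ltW b0).
  have aL : a ^+ L = (1 + b) ^+ L by rewrite /b [1 + _]addrC subrK.
  rewrite mulnC exprM aL.
  have Lb0 : 0 <= L%:R * b by rewrite mulr_ge0// ltW.
  have : (L%:R * b) ^+ 2 < ((1 + b) ^+ L) ^+ 2.
    by rewrite ltr_pXn2r ?nnegrE//; lra.
  apply: le_lt_trans.
  have Lge : e * n%:R / 2 + (K%:R - 1) <= L%:R.
    by rewrite /L natrD -natr1 in Llt *; lra.
  have K1 : 0 <= K%:R - 1 :> R by rewrite KE.
  set x := e * n%:R / 2 in Lge en0 *; set y := K%:R - 1 in Lge K1 Kb.
  apply: (@le_trans _ _ (b ^+ 2 * (4 * x * y))).
    have -> : b ^+ 2 * (4 * x * y) = n%:R * (2 * b ^+ 2 * e * y) by rewrite /x; field.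
    by rewrite ler_peMr.
  rewrite exprMn mulrC; apply: ler_wpM2r; first exact: sqr_ge0.
  have : (x + y) ^+ 2 <= L%:R ^+ 2 by rewrite lerXn2r ?nnegrE// addr_ge0.
  by have := sqr_ge0 (x - y); rewrite !expr2; lra.
apply: (@le_trans _ _ (\sum_(k < n) \sum_(l < 2 * L) (k.+1 == tau l)%:R)).
  apply: ler_sum => k _; case: asboolP => [|_]; last exact: sumr_ge0.
  move=> /explorationP[l kl].
  have lL : (l < 2 * L)%N.
    rewrite -(ltr_eXn2l a_gt1); apply: le_lt_trans nL.
    by apply: le_trans (tau_ge l) _; rewrite -kl ler_nat.
  by rewrite (bigD1 (Ordinal lL))//= kl eqxx lerDl; exact: sumr_ge0.
rewrite exchange_big/=; apply: (@le_trans _ _ (\sum_(l < 2 * L) 1)).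
  apply: ler_sum => l _.
  have [[k kl]|H] := pselect (exists k : 'I_n, k.+1 = tau l).
    rewrite (bigD1 k)//= kl eqxx big1 ?addr0// => k' kk'.
    by rewrite -kl eqSS (inj_eq val_inj) (negbTE kk').
  by rewrite big1// => k _; case: eqP => // kl; case: H; exists k.
rewrite sumr_const card_ord -[leLHS]mulr_natl mulr1 natrM /L natrD; lra.
Qed.

End ExplorationTimes.

(** * The threshold test: mean stopping time *)

Lemma expR_le_quadratic {R : realType} (z : R) : z <= 1/2 ->
  expR z <= 1 + z + 2 * z ^+ 2.
Proof.
move=> z1; have z0 : 0 < 1 - z by lra.
have : (1 - z) * expR z <= 1.
  rewrite -[leRHS](expRxMexpNx_1 z) mulrC ler_pM2l ?expR_gt0//.
  by have := expR_ge1Dx (- z); lra.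
rewrite mulrC -ler_pdivlMr// div1r => /le_trans; apply.
rewrite -[leLHS]mul1r ler_pdivrMr//.
have : 0 <= z ^+ 2 * (1 - 2 * z) by rewrite mulr_ge0 ?sqr_ge0//; lra.
by rewrite !expr2; lra.
Qed.

Section Concentration.
Context {R : realType} {Y U : finType} {M : nat} (p : 'I_M -> U -> Y -> Y -> R)
  (y0 : Y).
Hypotheses (p_gt0 : forall i u yt y, 0 < p i u yt y)
  (p_pmf : forall i u yt, is_pmf (p i u yt)).
Variables (i j : 'I_M) (r : R) (Q : Y -> U -> R).
Hypotheses (Q_pmf : cond_pmf Q).
Variables (q : seq (U * Y) -> U -> R) (bad : pred (seq (U * Y))).
Hypotheses (q_pmf : forall h, is_pmf (q h))
  (q_good : forall h, ~~ bad h -> q h =1 Q (last_obs y0 h)).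
Implicit Types (h : seq (U * Y)).
Local Notation E n f := (expect y0 q (p i) n f).

Definition bad_count h : R := path_sum (fun h _ => (bad h)%:R) h.

(** Corrected by a solution [f] of the Poisson equation, the log-likelihood
   ratio has centred increments, bounded by some [B], at the steps controlled by
   [Q]. Adding [B] at the other steps makes their increments nonnegative. The
   exponential moment of the sum [S] of all these increments grows at most
   by a factor [1 + 2 * (s * B) ^+ 2] per step, and Chernoff's inequality with
   [s] small yields a geometric bound. *)
Lemma llr_deviation (d : R) : 0 < d ->
  exists th k : R, [/\ 0 <= th < 1, 0 < k & exists n0, forall n, (n0 <= n)%N ->
    E n (fun h => (path_sum (llr p y0 i j) h
             <= n%:R * (info_rate p i j Q - 3 * d))%R%:R
           * (bad_count h <= k * n%:R)%R%:R) <= th ^+ n].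
Proof.
move=> d0; pose K := mixed_kernel p i Q; pose rt := info_rate p i j Q.
have [c c0 cp] := transition_lower_bound p_gt0.
have Kc yt y : c <= K yt y by exact: mixed_kernel_ge.
have K1 yt : \sum_y K yt y = 1 by exact: mixed_kernel_sum.
pose g yt := \sum_u Q yt u * kl_div (p i u yt) (p j u yt).
have [f fE] := poisson_equation y0 c0 Kc K1 g.
have {}fE yt : g yt + \sum_y K yt y * f y - f yt - rt = 0.
  have := fE yt; rewrite -[\sum_z _ * g z]info_rateE -/rt; lra.
pose inc h (x : U * Y) := llr p y0 i j h x + f x.2 - f (last_obs y0 h) - rt.
have [D D0 Dp] := log_ratio_bound p; have [F F0 Fb] := finite_norm_bound f.
pose B := D + F + F + `|rt| + 1.
have B1 : 1 <= B by rewrite /B; have := normr_ge0 rt; lra.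
have incB h x : `|inc h x| <= B.
  apply: le_trans (ler_normB _ _) _; apply: le_trans (lerD (ler_normB _ _) (lexx _)) _.
  apply: le_trans (lerD (lerD (ler_normD _ _) (lexx _)) (lexx _)) _.
  have := Dp i j x.1 (last_obs y0 h) x.2; have := Fb x.2; have := Fb (last_obs y0 h).
  by rewrite /B /llr; lra.
have inc0 h : ~~ bad h -> next y0 q (p i) h (inc h) = 0.
  move=> gh; rewrite -(fE (last_obs y0 h)).
  transitivity (next y0 q (p i) h (fun x => llr p y0 i j h x
      + (f x.2 + - (f (last_obs y0 h) + rt)))).
    by apply: eq_next => x; rewrite /inc; ring.
  rewrite nextD nextD (next_cst _ _ (q_pmf h) (p_pmf i)).
  have -> : next y0 q (p i) h (llr p y0 i j h) = g (last_obs y0 h).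
    by rewrite next_pair; apply: eq_bigr => u _; rewrite q_good.
  have -> : next y0 q (p i) h (fun x => f x.2) = \sum_y K (last_obs y0 h) y * f y.
    rewrite next_pair; under [RHS]eq_bigr => y _ do rewrite mulr_suml.
    rewrite exchange_big/=; apply: eq_bigr => u _; rewrite q_good// mulr_sumr.
    by apply: eq_bigr => y _; rewrite mulrA.
  by ring.
have q0 h u : 0 <= q h u by have [] := q_pmf h.
have p0 u yt y : 0 <= p i u yt y by exact: ltW.
pose s := Num.min 1 d / (4 * B ^+ 2).
have B2 : 0 < B ^+ 2 by rewrite exprn_gt0//; lra.
have s0 : 0 < s.
  by apply: divr_gt0; [rewrite lt_min ltr01 | rewrite mulr_gt0].
have sB2 : s * B ^+ 2 = Num.min 1 d / 4 by rewrite /s; field; rewrite gt_eqF//; lra.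
have sB : s * B <= 1/4.
  have : s * B <= s * B ^+ 2 by rewrite ler_pM2l// expr2 ler_peMr//; lra.
  have : Num.min 1 d <= 1 by rewrite ge_min lexx.
  by rewrite sB2; lra.
have sd : s * B ^+ 2 <= d / 4.
  have : Num.min 1 d <= d by rewrite ge_min lexx orbT.
  by rewrite sB2; lra.
pose W h (x : U * Y) := inc h x + B * (bad h)%:R.
have step h : next y0 q (p i) h (fun x => expR (- s * W h x)) <= 1 + 2 * (s * B) ^+ 2.
  have sB0 : 0 <= (s * B) ^+ 2 by exact: sqr_ge0.
  case: (boolP (bad h)) => [bh|gh].
    apply: (@le_trans _ _ 1); last by lra.
    rewrite -[leRHS](next_cst y0 1 (q_pmf h) (p_pmf i)); apply: le_next => // x.
    rewrite -expR0 ler_expR mulNr oppr_le0; apply: mulr_ge0; first exact: ltW.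
    rewrite /W bh mulr1; have := incB h x; rewrite ler_norml => /andP[]; lra.
  apply: (@le_trans _ _ (next y0 q (p i) h (fun x => 1 + 2 * (s * B) ^+ 2 + (- s) * inc h x))).
    apply: le_next => // x; rewrite /W (negbTE gh) mulr0 addr0.
    have xB := incB h x; have sx : `|s * inc h x| <= s * B.
      by rewrite normrM (gtr0_norm s0) ler_pM2l.
    have sx2 : (- s * inc h x) ^+ 2 <= (s * B) ^+ 2.
      rewrite -real_normK ?num_real// lerXn2r ?nnegrE//.
        by rewrite mulr_ge0 ?ltW//; lra.
      by rewrite mulNr normrN.
    apply: le_trans (expR_le_quadratic _) _; last by lra.
    by move: sx; rewrite ler_norml mulNr => /andP[? ?]; lra.
  by rewrite nextD (next_cst _ _ (q_pmf h) (p_pmf i)) nextZ inc0// mulr0 addr0.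
pose S := path_sum W.
have ES n : E n (fun h => expR (- s * S h)) <= (1 + 2 * (s * B) ^+ 2) ^+ n.
  elim: n => [|n IH].
    by rewrite /expect /S path_sum_nil mulr0 expR0.
  rewrite expectS exprS; apply: (@le_trans _ _
    ((1 + 2 * (s * B) ^+ 2) * E n (fun h => expR (- s * S h)))); last first.
    by apply: ler_wpM2l => //; rewrite addr_ge0// mulr_ge0// sqr_ge0.
  rewrite -expectZ; apply: le_expect => // h hn.
  rewrite [leRHS]mulrC; apply: le_trans (ler_wpM2l (expR_ge0 _) (step h)).
  rewrite -nextZ; apply: le_next => // x.
  by rewrite /S path_sum_rcons mulrDr expRD.
have SE h : S h = path_sum (llr p y0 i j) h + f (last_obs y0 h) - f y0
    - (size h)%:R * rt + B * bad_count h.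
  elim/last_ind: h => [|h x IH].
    by rewrite /S /bad_count !path_sum_nil /last_obs/=; ring.
  rewrite /S /bad_count !path_sum_rcons -/S -/(S h) IH -/(bad_count h) last_obs_rcons.
  by rewrite size_rcons -natr1 /W /inc; ring.
pose th := (1 + 2 * (s * B) ^+ 2) / (1 + s * d).
have sd0 : 0 < s * d by rewrite mulr_gt0.
have th1 : 0 <= th < 1.
  have q2 : 0 <= (s * B) ^+ 2 by exact: sqr_ge0.
  apply/andP; split; first by rewrite /th divr_ge0//; lra.
  rewrite /th ltr_pdivrMr; last by lra.
  have : s * (s * B ^+ 2) <= s * (d / 4) by rewrite ler_pM2l.
  by rewrite exprMn !expr2; lra.
exists th, (d / B); split => //.
  by rewrite divr_gt0//; lra.
exists (Num.truncn (2 * F / d)).+1 => n n0n.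
have nF : 2 * F / d <= n%:R.
  by apply/ltW/(lt_le_trans (truncnS_gt _)); rewrite ler_nat.
have Fn : 2 * F <= d * n%:R by rewrite ler_pdivrMr// [n%:R * d]mulrC in nF.
apply: (@le_trans _ _ (expR (- s * (d * n%:R)) * (1 + 2 * (s * B) ^+ 2) ^+ n)); last first.
  rewrite /th expr_div_n mulrC; apply: ler_wpM2l.
    by rewrite exprn_ge0// addr_ge0// mulr_ge0// sqr_ge0.
  have -> : - s * (d * n%:R) = n%:R * - (s * d) by ring.
  rewrite expRM_natl expRN exprVn lef_pV2 ?posrE ?exprn_gt0 ?expR_gt0//; last by lra.
  by rewrite lerXn2r ?nnegrE ?expR_ge0//; [lra | exact: expR_ge1Dx].
apply: le_trans (ler_wpM2l (expR_ge0 _) (ES n)).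
rewrite -expectZ; apply: le_expect => // h hn.
case: (boolP (path_sum _ _ <= _)) => [Lh|_]; last by rewrite mul0r mulr_ge0 ?expR_ge0.
case: (boolP (bad_count h <= _)) => [bh|_]; last by rewrite mulr0 mulr_ge0 ?expR_ge0.
rewrite mulr1 -expRD -[leLHS]expR0 ler_expR -mulrDr mulNr oppr_ge0.
rewrite pmulr_rle0// SE hn.
have Bb : B * bad_count h <= d * n%:R.
  have Bp : 0 < B by lra.
  rewrite -(ler_pM2l Bp) in bh; apply: le_trans bh _.
  by rewrite mulrA mulrCA divff ?mulr1 ?gt_eqF.
move: Lh; rewrite mulrBr -/rt => Lh.
have := Fb (last_obs y0 h); have := Fb y0; rewrite !ler_norml => /andP[? ?] /andP[? ?].
by lra.
Qed.

End Concentration.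

Section Series.
Context {R : realType}.

Lemma sum_lt_nat n K : \sum_(m < n) (m < K)%N%:R <= K%:R :> R.
Proof.
rewrite -natr_sum ler_nat; suff -> : (\sum_(m < n) (m < K) = minn n K)%N by exact: geq_minr.
elim: n => [|n IH]; first by rewrite big_ord0 min0n.
by rewrite big_ord_recr/= IH; case: (ltnP n K) => nK /=; lia.
Qed.

Lemma sum_geometric_le (th : R) N : 0 <= th < 1 -> \sum_(n < N) th ^+ n <= (1 - th)^-1.
Proof.
move=> /andP[th0 th1]; have p0 : 0 < 1 - th by rewrite subr_gt0.
rewrite -[leRHS]mul1r ler_pdivlMr//.
have -> : (\sum_(n < N) th ^+ n) * (1 - th) = 1 - th ^+ N.
  elim: N => [|N IH]; first by rewrite big_ord0 mul0r expr0 subrr.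
  by rewrite big_ord_recr/= mulrDl IH exprS; ring.
by rewrite lerBlDr lerDl exprn_ge0.
Qed.

(** Telescoping: [(n + 1) * (n + 2) <= 6 * n ^+ 2] for [n >= 1]. *)
Lemma bounded_series (b : nat -> R) (n0 : nat) (th c : R) :
  (forall n, b n <= 1) -> 0 <= th < 1 -> 0 <= c ->
  (forall n, (n0 < n)%N -> b n <= th ^+ n + c / n%:R ^+ 2) ->
  exists C : R, forall N, \sum_(n < N) b n <= C.
Proof.
move=> b1 th01 c0 Hb; exists (n0.+1%:R + (1 - th)^-1 + 6 * c) => N.
have th0 : 0 <= th by case/andP: th01.
apply: (@le_trans _ _ (\sum_(n < N) ((n < n0.+1)%N%:R + th ^+ n
    + 6 * c * ((n.+1%:R)^-1 - (n.+2%:R)^-1)))).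
  apply: ler_sum => n _; have tn : 0 <= th ^+ n by exact: exprn_ge0.
  have x0 : 0 < n.+1%:R :> R by rewrite ltr0n.
  have x1 : 0 < n.+2%:R :> R by rewrite ltr0n.
  have -> : (n.+1%:R)^-1 - (n.+2%:R)^-1 = (n.+1%:R * n.+2%:R)^-1 :> R.
    by rewrite -[n.+2%:R]natr1 in x1 *; field; rewrite !gt_eqF.
  have q0 : 0 <= 6 * c / (n.+1%:R * n.+2%:R) by rewrite divr_ge0 ?mulr_ge0.
  have [nn0|n0n] /= := ltnP n n0.+1.
    by apply: le_trans (b1 n) _; rewrite -addrA lerDl addr_ge0.
  rewrite add0r; apply: le_trans (Hb n n0n) _; rewrite lerD2l.
  have n1 : 1 <= n%:R :> R by rewrite ler1n (leq_trans _ n0n).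
  rewrite [6 * c]mulrC -mulrA; apply: ler_wpM2l => //.
  rewrite -[leLHS]mul1r ler_pdivrMr ?exprn_gt0//; last by lra.
  rewrite mulrAC ler_pdivlMr ?mulr_gt0// mul1r -!natr1.
  have : 0 <= (n%:R - 1) * (5 * n%:R + 2) :> R by rewrite mulr_ge0//; lra.
  by rewrite !expr2; lra.
rewrite !big_split/=; apply: lerD; first by apply: lerD; [exact: sum_lt_nat | exact: sum_geometric_le].
rewrite -mulr_sumr; apply: ler_piMr; first by rewrite mulr_ge0.
have -> : \sum_(n < N) ((n.+1%:R)^-1 - (n.+2%:R)^-1) = 1 - (N.+1%:R)^-1 :> R.
  elim: N => [|N IH]; first by rewrite big_ord0 invr1 subrr.
  by rewrite big_ord_recr/= IH; ring.
by rewrite lerBlDr lerDl.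
Qed.

End Series.

Section StarMean.
Context {R : realType} {Y U : finType} {M : nat} (p : 'I_M -> U -> Y -> Y -> R)
  (y0 : Y).
Hypotheses (M_gt1 : (1 < M)%N) (p_gt0 : forall i u yt y, 0 < p i u yt y)
  (p_pmf : forall i u yt, is_pmf (p i u yt)).
Variables (rho a : R) (qs : 'I_M -> Y -> U -> R) (X : controlled_process p y0)
  (mle : seq (U * Y) -> 'I_M) (i : 'I_M).
Hypotheses (rho_gt0 : 0 < rho) (a_gt1 : 1 < a) (arho : a ^+ 3 * rho <= 1)
  (rhoP : forall i j u yt y, p i u yt y != p j u yt y -> forall q n,
    (forall h, is_pmf (q h)) -> (forall h v, size h = n.+1 -> q h v = #|U|%:R^-1) ->
    affinity p y0 i j q n.+2 <= rho * affinity p y0 i j q n.+1)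
  (qs_max : forall i, is_maximizer p i (qs i))
  (X_star : policy X =2 star_policy y0 a qs mle) (mleP : is_mle X mle)
  (v_gt0 : 0 < v_opt p i).
Implicit Types (h : seq (U * Y)) (j : 'I_M).
Local Notation q := (policy X).
Local Notation E n f := (expect y0 q (p i) n f).
Local Notation J j h := (joint_pmf p y0 q j h).

Let q_pmf h : is_pmf (q h). Proof. exact: policy_pmf. Qed.
Let q_ge0 h u : 0 <= q h u. Proof. by have [] := q_pmf h. Qed.
Let p_ge0 u yt y : 0 <= p i u yt y. Proof. exact: ltW. Qed.

Lemma v_opt_le_rate j : j != i -> v_opt p i <= info_rate p i j (qs i).
Proof.
move=> ji; rewrite -(maximizer_v_opt y0 p_gt0 p_pmf M_gt1 (qs_max i)).
exact: (min_info_le y0 p_gt0 p_pmf (qs_max i).1).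
Qed.

Lemma distinguishable j : j != i -> exists u yt y, p i u yt y != p j u yt y.
Proof.
move=> ji; apply: contrapT => H; have := lt_le_trans v_gt0 (v_opt_le_rate ji).
suff -> : info_rate p i j (qs i) = 0 by rewrite ltxx.
apply: big1 => yt _; apply: big1 => u _; rewrite /kl_div big1 ?mulr0// => y _.
have -> : p j u yt y = p i u yt y.
  by apply/esym/eqP/negPn/negP => pij; apply: H; exists u, yt, y.
by rewrite divff ?gt_eqF// ln1 mulr0.
Qed.

Lemma affinity_decay j : j != i ->
  exists2 C : R, 0 <= C & forall n, affinity p y0 i j q n * n%:R ^+ 3 <= C.
Proof.
move=> /distinguishable[u [yt [y pij]]].
apply: (@exploration_decay _ a a_gt1 rho) => // n.
- by rewrite affinity_ge0// affinity_le1.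
- exact: affinity_decr.
- move=> ex; apply: (rhoP pij) => // h v hn.
  by rewrite X_star /star_policy hn; case: asboolP.
Qed.

Lemma mistake_bound :
  exists2 C : R, 0 <= C & forall n, E n (fun h => (mle h != i)%:R) * n%:R ^+ 3 <= C.
Proof.
have /choice[C HC] : forall j, exists C : R, 0 <= C /\ (j != i -> forall n,
    affinity p y0 i j q n * n%:R ^+ 3 <= C).
  move=> j; case: (eqVneq j i) => [_|ji]; first by exists 0.
  by have [C C0 HC] := affinity_decay ji; exists C.
exists (\sum_(j < M | j != i) C j) => [|n].
  by apply: sumr_ge0 => j _; exact: (HC j).1.
apply: (@le_trans _ _ (\sum_(j < M | j != i) affinity p y0 i j q n * n%:R ^+ 3)); last first.
  by apply: ler_sum => j ji; exact: (HC j).2.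
rewrite -mulr_suml; apply: ler_wpM2r; first exact: exprn_ge0.
apply: (@le_trans _ _ (\sum_(j < M | j != i)
    E n (fun h => (J i h <= J j h)%R%:R))); last first.
  by apply: ler_sum => j _; exact: expect_mistaken.
rewrite -expect_sum; apply: le_expect => // h _.
case: (boolP (mle h != i)) => [hi|_]; last by apply: sumr_ge0.
by rewrite (bigD1 (mle h))//= mleP lerDl; apply: sumr_ge0.
Qed.

Let bad h : bool := (mle h != i) || `[< exploration a (size h).+1 >].

Let q_good h : ~~ bad h -> q h =1 qs i (last_obs y0 h).
Proof.
move=> /norP[/negPn/eqP hi /asboolP ex] u; rewrite X_star /star_policy hi.
by case: asboolP.
Qed.

(** Errors of the estimate before the time [k / 3 * n], and exploration, make up
   at most [k * n] bad steps; one more requires a late error. *)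
Lemma bad_count_le (k : R) : 0 < k -> exists2 n0, (0 < n0)%N & forall n h, (n0 <= n)%N -> size h = n ->
  (k * n%:R < bad_count bad h)%R%:R
  <= \sum_(m < n | k / 3 * n%:R <= m%:R) (mle (take m h) != i)%:R :> R.
Proof.
move=> k0; have k3 : 0 < k / 3 by rewrite divr_gt0.
have [C C0 HC] := exploration_count a_gt1 k3.
exists (Num.truncn ((C + 1) / (k / 3))).+1 => // n h n0n hn.
have Cn : C + 1 <= k / 3 * n%:R.
  rewrite mulrC -ler_pdivrMr//; apply/ltW/(lt_le_trans (truncnS_gt _)).
  by rewrite ler_nat.
case: (boolP (_ < bad_count _ _)) => [bn|_]; last exact: sumr_ge0.
apply: contrapT => /negP; rewrite -ltNge => lt1.
have good (m : 'I_n) : k / 3 * n%:R <= m%:R -> mle (take m h) = i.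
  move=> km; apply/eqP/negPn/negP => mi; move: lt1; rewrite ltNge => /negP; apply.
  by rewrite (bigD1 m)//= mi lerDl; apply: sumr_ge0.
move: bn; rewrite ltNge => /negP; apply.
have kn0 : 0 <= k / 3 * n%:R by rewrite mulr_ge0// ltW.
apply: (@le_trans _ _ (\sum_(m < n) ((m < (Num.truncn (k / 3 * n%:R)).+1)%N%:R
    + `[< exploration a m.+1 >]%:R))).
  rewrite /bad_count /path_sum hn; apply: ler_sum => m _.
  rewrite /bad size_takel; last by rewrite hn ltnW.
  have [km|mk] := leP (k / 3 * n%:R) m%:R; first by rewrite good// eqxx/= lerDr.
  have -> : (m < (Num.truncn (k / 3 * n%:R)).+1)%N.
    by rewrite ltnS truncn_ge_nat// ltW.
  by case: asboolP => _; case: (_ != _); rewrite /= ?addr0 ?lerDl.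
have /andP[tr _] := truncn_itv kn0; have expl := HC n.
have early := @sum_lt_nat R n (Num.truncn (k / 3 * n%:R)).+1.
rewrite -[leRHS]natr1 in early; rewrite big_split/=; apply: le_trans (lerD early expl) _.
have -> : k * n%:R = 3 * (k / 3 * n%:R) by field.
by lra.
Qed.

(** The late errors of the estimate have probabilities of the order of [n ^- 3]
   each, hence [n ^- 2] together; without them the bad steps are few, and the
   deviation bound is geometric. *)
Lemma llr_small_summable j (d : R) : j != i -> 0 < d -> exists C : R, forall N,
  \sum_(n < N) E n (fun h => (path_sum (llr p y0 i j) h
    <= n%:R * (info_rate p i j (qs i) - 3 * d))%R%:R) <= C.
Proof.
move=> ji d0.
have [th [k [th01 k0 [n1 dev]]]] :=
  llr_deviation p_gt0 p_pmf i j (qs_max i).1 q_pmf q_good d0.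
have [n2 n2_gt0 badP] := bad_count_le k0.
have [C C0 HC] := mistake_bound.
have k3 : 0 < k / 3 by rewrite divr_gt0.
apply: (@bounded_series _ (fun n => E n (fun h => (path_sum (llr p y0 i j) h
    <= n%:R * (info_rate p i j (qs i) - 3 * d))%R%:R)) (n1 + n2)%N th (C / (k / 3) ^+ 3)) => //.
- move=> n; rewrite -[leRHS](expect_cst y0 q_pmf (p_pmf i) n 1).
  by apply: le_expect => // h _; rewrite lern1 leq_b1.
- by rewrite divr_ge0// exprn_ge0// ltW.
move=> n n12; have n1n : (n1 <= n)%N by rewrite (leq_trans _ (ltnW n12))// leq_addr.
have n2n : (n2 <= n)%N by rewrite (leq_trans _ (ltnW n12))// leq_addl.
have n0 : 0 < n%:R :> R by rewrite ltr0n (leq_trans _ n2n).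
apply: le_trans (lerD (dev n n1n) (lexx _)).
rewrite -lerBlDl -expectB.
apply: (@le_trans _ _ (E n (fun h => \sum_(m < n | k / 3 * n%:R <= m%:R)
    (mle (take m h) != i)%:R))).
  apply: le_expect => // h hn; apply: le_trans (badP n h n2n hn).
  rewrite ltNge; case: (path_sum _ _ <= _); case: (bad_count _ _ <= _);
    by rewrite /= ?mulr1 ?mulr0 ?mul0r ?subrr ?subr0.
rewrite expect_sum; apply: (@le_trans _ _ (\sum_(m < n) C / (k / 3 * n%:R) ^+ 3)).
  rewrite big_mkcond; apply: ler_sum => m _.
  have kn0 : 0 < k / 3 * n%:R by rewrite mulr_gt0.
  have K0 : 0 <= C / (k / 3 * n%:R) ^+ 3 by rewrite divr_ge0// exprn_ge0// ltW.
  case: ifPn => // km.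
  rewrite (expect_take y0 q_pmf (p_pmf i) (fun h => (mle h != i)%:R) (ltnW (ltn_ord m))).
  rewrite ler_pdivlMr ?exprn_gt0//; apply: le_trans (HC m).
  apply: ler_wpM2l; first exact: expect_ge0.
  by rewrite lerXn2r ?nnegrE// ltW.
rewrite sumr_const card_ord -[leLHS]mulr_natl le_eqVlt; apply/orP; left; apply/eqP.
by field; rewrite !gt_eqF.
Qed.

(** If every other hypothesis were [T] times less likely than [i], then [i] would
   be the estimate and the test would stop. *)
Lemma star_alive_llr (T : R) h : 1 <= T -> (0 < size h)%N -> star_alive X mle T h ->
  0 < J i h -> exists2 j, j != i & path_sum (llr p y0 i j) h <= ln T.
Proof.
move=> T1 h0 /star_aliveP /(_ (size h) (leqnn _)); rewrite take_size => ns Ji.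
apply: contrapT => H; move/negP: ns; apply.
have T0 : 0 < T by exact: lt_le_trans T1.
have JT j : j != i -> 0 < J j h /\ T * J j h < J i h.
  move=> ji; have Jj : 0 < J j h.
    by rewrite (joint_pmf_llr y0 p_gt0 i j) mulr_gt0// expR_gt0.
  split=> //; rewrite (joint_pmf_llr y0 p_gt0 j i) mulrC ltr_pM2l//.
  rewrite -[ltLHS]lnK ?posrE// ltr_expR ltNge; apply/negP => Lj.
  by apply: H; exists j.
have hi : mle h = i.
  apply/eqP/negPn/negP => /JT[Jm Tm]; have := mleP h i.
  rewrite leNgt => /negP; apply; apply: le_lt_trans Tm.
  by rewrite ler_peMl// ltW.
rewrite /star_stop_at h0 hi /=; set m := \big[_/_]_(_ < _ | _) _.
have [j ji] : exists j : 'I_M, j != i.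
  pose k0 := Ordinal (ltnW M_gt1); pose k1 := Ordinal M_gt1.
  by case: (eqVneq k0 i) => [<-|]; [exists k1 | exists k0].
have m0 : 0 < m.
  apply: lt_le_trans (JT j ji).1 _.
  exact: (le_bigmax_cond _ (fun j => J j h)).
rewrite ltr_pdivlMr// -ltr_pdivlMl//; apply: bigmax_lt => [|k ki].
  by rewrite mulr_gt0// invr_gt0.
by rewrite ltr_pdivlMl//; exact: (JT k ki).2.
Qed.

(** After [(1 + e) * ln T / v_opt p i] steps, [ln T] lies below the level at which
   the probabilities of small log-likelihood ratios are summable. *)
Lemma star_mean_time (e : R) : 0 < e -> exists C : R, forall T : R, 1 <= T ->
  (mean_time (star_test X mle T) i <= ((1 + e) * ln T / v_opt p i + C)%:E)%E.
Proof.
move=> e0; set v := v_opt p i.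
have e1 : 0 < 1 + e by lra.
pose d := (v - v / (1 + e)) / 3.
have d0 : 0 < d.
  rewrite divr_gt0// subr_gt0 ltr_pdivrMr// ltr_pMr//; lra.
have /choice[C HC] : forall j, exists C : R, j != i -> forall N,
    \sum_(n < N) E n (fun h => (path_sum (llr p y0 i j) h
      <= n%:R * (info_rate p i j (qs i) - 3 * d))%R%:R) <= C.
  move=> j; case: (eqVneq j i) => [_|ji]; first by exists 0.
  by have [C HC] := llr_small_summable ji d0; exists C.
exists (2 + \sum_(j < M | j != i) C j) => T T1.
have T0 : 0 < T by exact: lt_le_trans T1.
have lnT : 0 <= ln T by rewrite ln_ge0.
pose x := (1 + e) * ln T / v.
have x0 : 0 <= x by rewrite divr_ge0 ?mulr_ge0// ltW.
apply: (@mean_time_le _ _ _ _ _ _ (star_test X mle T) _ p_gt0 (star_survival X mle T)) => N /=.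
pose B j n := E n (fun h => (path_sum (llr p y0 i j) h
      <= n%:R * (info_rate p i j (qs i) - 3 * d))%R%:R).
have B0 j n : 0 <= B j n by apply: expect_ge0.
apply: (@le_trans _ _ (\sum_(n < N) ((n < (Num.truncn x).+2)%N%:R
    + \sum_(j < M | j != i) B j n))); last first.
  rewrite big_split/= exchange_big/=; apply: le_trans (lerD (sum_lt_nat _ _) (lexx _)) _.
  have /andP[tr _] := truncn_itv x0.
  rewrite -/x addrA; apply: lerD; first by rewrite -!natr1; lra.
  by apply: ler_sum => j ji; exact: (HC j ji N).
apply: ler_sum => n _; have [nx|xn] := ltnP n (Num.truncn x).+2.
  apply: (@le_trans _ _ 1); last by rewrite /= lerDl; apply: sumr_ge0.
  rewrite -[leRHS](expect_cst y0 q_pmf (p_pmf i) n 1).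
  by apply: le_expect => // h _; rewrite lern1 leq_b1.
rewrite /= add0r -expect_sum.
apply: (@le_expect_support _ _ _ _ y0 p q i n _ _ q_ge0 (p_gt0 i)) => h hn J0.
case: (boolP (star_alive _ _ _ _)) => [ah|_]; last by apply: sumr_ge0.
have [|j ji Lj] := star_alive_llr T1 _ ah J0; first by rewrite hn (leq_trans _ xn).
rewrite (bigD1 j)//= (le_trans Lj) ?lerDl; first by apply: sumr_ge0.
have xn' : x <= n%:R.
  by apply/ltW/(lt_le_trans (truncnS_gt x)); rewrite ler_nat ltnW.
have rd : v / (1 + e) <= info_rate p i j (qs i) - 3 * d.
  by have := v_opt_le_rate ji; rewrite -/v /d; lra.
have n0 : 0 <= n%:R :> R by [].
apply: le_trans (ler_wpM2l n0 rd).
rewrite mulrA ler_pdivlMr//; move: xn'; rewrite /x ler_pdivrMr//; lra.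
Qed.

End StarMean.

(** * Asymptotic optimality *)

Lemma near_pinfty_gt {R : realType} (P : R -> Prop) :
  (exists T0 : R, forall T, T0 < T -> P T) -> \forall T \near pinfty_nbhs R, P T.
Proof. by move=> [T0 H]; exists T0; split; [exact: num_real | exact: H]. Qed.

Lemma asymp_eq_pinfty {R : realType} (f g : R -> \bar R) :
  (exists T0 : R, forall T, T0 < T -> f T = +oo%E /\ g T = +oo%E) ->
  asymp_eq (pinfty_nbhs R) f g.
Proof.
move=> [T0 H]; exists (fun=> 0); first exact: cvg_cst.
apply: near_pinfty_gt; exists T0 => T /H[-> ->].
by rewrite addr0 mule1.
Qed.

(** Being of the order of [ln T], both functions are finite and nonzero, which
   makes their quotient the required correction. *)
Lemma asymp_eq_squeeze {R : realType} (v : R) (f g : R -> \bar R) : 0 < v ->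
  (forall e : R, 0 < e < 1 -> exists T0 : R, forall T, T0 < T ->
    [/\ (f T <= ((1 + e) * ln T / v)%:E)%E, (((1 - e) * ln T / v)%:E <= g T)%E &
        (g T * (1 - e)%:E <= f T)%E]) ->
  asymp_eq (pinfty_nbhs R) f g.
Proof.
move=> v0 H.
have fg (e T : R) : 0 < e < 1 -> 1 < T ->
    (f T <= ((1 + e) * ln T / v)%:E)%E -> (((1 - e) * ln T / v)%:E <= g T)%E ->
    (g T * (1 - e)%:E <= f T)%E ->
    exists x y, [/\ f T = x%:E, g T = y%:E, 0 < y, y * (1 - e) <= x &
      x * (1 - e) <= y * (1 + e)].
  move=> /andP[e0 e1] T1; have lT : 0 < ln T by rewrite ln_gt0.
  have E0 : 0 < (1 - e) * ln T / v by rewrite divr_gt0// mulr_gt0// subr_gt0.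
  case: (f T) => [x| |]//; case: (g T) => [y| |]//.
  - rewrite -EFinM !lee_fin => fle gle gf; exists x, y; split => //.
      exact: lt_le_trans gle.
    apply: (@le_trans _ _ ((1 + e) * ln T / v * (1 - e))).
      by rewrite ler_wpM2r// subr_ge0 ltW.
    rewrite (_ : _ * (1 - e) = (1 - e) * ln T / v * (1 + e)); last by ring.
    by rewrite ler_wpM2r// addr_ge0// ltW.
  - by move=> _ _; rewrite gt0_mulye ?lte_fin ?subr_gt0.
  - by move=> _ _; rewrite gt0_mulye ?lte_fin ?subr_gt0.
exists (fun T => fine (f T) / fine (g T) - 1); last first.
  have half : 0 < (1/2 : R) < 1 by lra.
  have [T0 HT0] := H _ half.
  apply: near_pinfty_gt; exists (Num.max T0 1) => T; rewrite gt_max => /andP[/HT0[h1 h2 h3] T1].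
  have [x [y [-> -> y0 _ _]]] := fg _ T half T1 h1 h2 h3.
  by rewrite -EFinM /= addrC subrK mulrC divfK// gt_eqF.
apply/cvgrPdist_le => e e0.
pose d := Num.min (1/2) (e / 4).
have d0 : 0 < d by rewrite lt_min; lra.
have d1 : d <= 1/2 by rewrite ge_min lexx.
have d2 : d <= e / 4 by rewrite ge_min lexx orbT.
have d01 : 0 < d < 1 by lra.
have [T0 HT0] := H d d01.
apply: near_pinfty_gt; exists (Num.max T0 1) => T; rewrite gt_max => /andP[/HT0[h1 h2 h3] T1].
have [x [y [-> -> y0 lo hi]]] := fg d T d01 T1 h1 h2 h3.
rewrite /= sub0r normrN ler_norml lerBlDr lerBrDr.
rewrite ler_pdivlMr// ler_pdivrMr//; apply/andP; split.
  by apply: le_trans lo; rewrite mulrC ler_pM2l//; lra.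
have dd : 0 < 1 - d by lra.
rewrite -(ler_pM2r dd); apply: le_trans hi _.
rewrite mulrAC [_ * y]mulrC ler_pM2l//.
have : d * e <= 1/2 * e by rewrite ler_pM2r.
by rewrite mulrDl mul1r [e * _]mulrC mulrBl mul1r; lra.
Qed.

Section Optimality.
Context {R : realType} {Y U : finType} {M : nat} (p : 'I_M -> U -> Y -> Y -> R)
  (y0 : Y).
Hypotheses (M_gt1 : (1 < M)%N) (p_gt0 : forall i u yt y, 0 < p i u yt y)
  (p_pmf : forall i u yt, is_pmf (p i u yt)).
Implicit Types (t : sequential_test p y0) (i : 'I_M).

Lemma neg_ln_ge (b e : R) : 0 < b -> 0 < e -> exists2 T0 : R, 1 < T0 &
  forall T (x : \bar R), T0 < T -> (0 <= x)%E -> (x <= (b / T)%:E)%E ->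
    (((1 - e) * ln T)%:E <= - lne x)%E.
Proof.
move=> b0 e0; exists (Num.max 2 (expR (ln b / e))); first by rewrite lt_max ltr1n.
move=> T x; rewrite gt_max => /andP[T2 bT] x0 xb.
have T0 : 0 < T by lra.
have lT : ln b <= e * ln T.
  rewrite mulrC -ler_pdivrMr// -ler_expR lnK ?posrE//; exact: ltW.
apply: le_trans (le_oppe_lne x0 xb).
rewrite lne_EFin ?divr_gt0// -EFinN lee_fin ln_div ?posrE//.
by lra.
Qed.

(** The infima range over classes of tests that depend on [T], so a threshold
   that depends on [e] only is needed. *)
Lemma converse_uniform i (e : R) : 0 < e < 1 -> exists2 T0 : R, 1 < T0 &
  forall T t, T0 < T -> (Pmax t <= ((M%:R * M%:R) / T)%:E)%E ->
  [/\ (- lne (risk t i) / (v_opt p i)%:E * (1 - e)%:E <= mean_time t i)%E,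
      (((1 - e) * ln T)%:E / (v_opt p i)%:E <= - lne (risk t i) / (v_opt p i)%:E)%E &
      (((1 - e) * ln T)%:E / (v_opt p i)%:E <= - lne (Pmax t) / (v_opt p i)%:E)%E].
Proof.
move=> /andP[e0 e1]; have [C C0 HC] := converse_test y0 M_gt1 p_gt0 p_pmf.
have [d /andP[d0 d1] Hd] := converse_err_small C0 e0.
pose b : R := M%:R * M%:R.
have b0 : 0 < b by rewrite mulr_gt0// ltr0n ltnW.
have [T1 T11 HT1] := neg_ln_ge b0 e0.
exists (Num.max T1 (b / d)) => [|T t]; first by rewrite lt_max T11.
rewrite gt_max => /andP[TT1 bdT] Pb.
have v0 := inve_v_opt_ge0 M_gt1 p_gt0 p_pmf t i.
have T0 : 0 < T by lra.
have P0 : 0 <= fine (Pmax t) by rewrite -lee_fin fine_Pmax Pmax_ge0.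
have Pd : fine (Pmax t) <= d.
  rewrite -lee_fin fine_Pmax; apply: le_trans Pb _; rewrite lee_fin.
  by rewrite ler_pdivrMr// [d * T]mulrC -ler_pdivrMr// ltW.
have err := Hd _ P0 Pd; split.
- apply: le_trans (HC t i _ _); [|lra|lra].
  apply: lee_wpmul2l; last by rewrite lee_fin; lra.
  rewrite mule_ge0// oppe_lne_ge0// risk_ge0/=.
  exact: le_trans (risk_le_Pmax _ _) (Pmax_le1 _).
- apply: lee_wpmul2r => //; apply: HT1 => //; first exact: risk_ge0.
  exact: le_trans (risk_le_Pmax _ _) Pb.
- by apply: lee_wpmul2r => //; apply: HT1 => //; exact: Pmax_ge0.
Qed.

Lemma inf_mean_time_ge i (C : sequential_test p y0 -> Prop) (x : \bar R) :
  (forall t, C t -> (x <= mean_time t i)%E) -> (x <= inf_mean_time C i)%E.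
Proof. by move=> Cx; apply: le_ereal_inf_tmp => _ [t Ct ->]; exact: Cx. Qed.

Lemma inf_mean_time_le i (C : sequential_test p y0 -> Prop) t :
  C t -> (inf_mean_time C i <= mean_time t i)%E.
Proof. by move=> Ct; apply: ereal_inf_lbound; exists t. Qed.

(** The same sandwich serves the four comparisons. When [v_opt p i] vanishes,
   its inverse is infinite and so are both sides for [T] large. *)
Lemma mean_time_asymp_eq i (s : R -> sequential_test p y0) (g : R -> \bar R) :
  (forall T : R, 0 < T -> (Pmax (s T) <= ((M%:R - 1) / T)%:E)%E) ->
  (0 < v_opt p i -> forall e : R, 0 < e -> exists C : R, forall T : R, 1 <= T ->
    (mean_time (s T) i <= ((1 + e) * ln T / v_opt p i + C)%:E)%E) ->
  (forall e : R, 0 < e < 1 -> exists T0 : R, forall T : R, T0 < T ->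
    (((1 - e) * ln T)%:E / (v_opt p i)%:E <= g T)%E /\
    (g T * (1 - e)%:E <= mean_time (s T) i)%E) ->
  asymp_eq (pinfty_nbhs R) (fun T => mean_time (s T) i) g.
Proof.
move=> sP sup gP; have v0 := test_v_opt_ge0 M_gt1 p_gt0 p_pmf (s 1) i.
have half : 0 < (1/2 : R) < 1 by lra.
have [v_eq0|v_neq0] := eqVneq (v_opt p i) 0.
  apply: asymp_eq_pinfty; have [T0 HT0] := gP _ half.
  exists (Num.max T0 1) => T; rewrite gt_max => /andP[/HT0 + T1].
  have lT : 0 < ln T by rewrite ln_gt0.
  rewrite v_eq0 inve0 gt0_muley; last by rewrite lte_fin mulr_gt0//; lra.
  rewrite leye_eq => -[/eqP ->]; rewrite gt0_mulye ?lte_fin; last lra.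
  by rewrite leye_eq => /eqP ->.
have {}v0 : 0 < v_opt p i by rewrite lt_neqAle eq_sym v_neq0.
apply: (asymp_eq_squeeze v0) => e e01; have /andP[e0 e1] := e01.
have [T0 HT0] := gP _ e01; have e2 : 0 < e / 2 by lra.
have [C HC] := sup v0 _ e2.
exists (Num.max T0 (Num.max 1 (expR (2 * C * v_opt p i / e)))) => T.
rewrite !gt_max => /and3P[/HT0[g1 g2] T1 CT]; split => //.
- apply: le_trans (HC T (ltW T1)) _; rewrite lee_fin.
  have T00 : 0 < T by lra.
  have : C <= e / 2 * ln T / v_opt p i.
    rewrite ler_pdivlMr//.
    have : 2 * C * v_opt p i / e <= ln T by rewrite -ler_expR lnK ?posrE// ltW.
    by rewrite ler_pdivrMr//; lra.
  by rewrite !mulrDl; lra.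
- by move: g1; rewrite inver (negbTE v_neq0).
Qed.

(** [a] is close enough to 1 when the estimate errs at time [n] with probability
   of the order of [n ^- 3]. *)
Lemma achievability (qs : 'I_M -> Y -> U -> R) :
  (forall i, is_maximizer p i (qs i)) ->
  exists2 a0 : R, 1 < a0 &
  forall a : R, 1 < a < a0 ->
  forall (X : controlled_process p y0) (mle : seq (U * Y) -> 'I_M),
    policy X =2 star_policy y0 a qs mle -> is_mle X mle ->
    forall i, 0 < v_opt p i -> forall e : R, 0 < e -> exists C : R, forall T : R, 1 <= T ->
      (mean_time (star_test X mle T) i <= ((1 + e) * ln T / v_opt p i + C)%:E)%E.
Proof.
move=> qs_max; have [rho /andP[rho0 rho1] rhoP] := exploration_rate y0 p_gt0 p_pmf.
(* (1 + d) ^+ 3 <= 1 + 7 * d for d <= 1, so the cube of a is at most rho^-1 *)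
pose d := Num.min 1 ((rho^-1 - 1) / 7).
have r1 : 1 < rho^-1 by rewrite invf_gt1.
have d0 : 0 < d by rewrite lt_min ltr01/= divr_gt0// subr_gt0.
exists (1 + d) => [|a /andP[a1 ad] X mle X_star mleP i v0]; first lra.
have d1 : d <= 1 by rewrite ge_min lexx.
have d2 : d <= (rho^-1 - 1) / 7 by rewrite ge_min lexx orbT.
have arho : a ^+ 3 * rho <= 1.
  rewrite -ler_pdivlMr// div1r.
  have b0 : 0 < a - 1 by lra.
  have bb : (a - 1) * (a - 1) <= a - 1 by rewrite ler_piMl; lra.
  have bbb : (a - 1) * (a - 1) * (a - 1) <= a - 1.
    by apply: le_trans bb; rewrite ler_piMr//; [rewrite mulr_ge0; lra | lra].
  by rewrite !exprS expr0; lra.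
exact: (star_mean_time M_gt1 p_gt0 p_pmf rho0 a1 arho (fun i j u yt y pij => rhoP i j u yt y pij)
  qs_max X_star mleP v0).
Qed.

End Optimality.

Theorem theorem4p1 (R : realType) (Y U : finType) (M : nat)
    (p : 'I_M -> U -> Y -> Y -> R) (y0 : Y)
    (hM : (1 < M)%N)
    (p_gt0 : forall i u yt y, 0 < p i u yt y)
    (p_pmf : forall i u yt, is_pmf (p i u yt)) :
  (forall t : nat -> sequential_test p y0,
      Pmax (t n) @[n --> \oo] --> (0 : \bar R) ->
      forall i : 'I_M, exists e1 e2 : nat -> R,
        [/\ e1 n @[n --> \oo] --> (0 : R),
            e2 n @[n --> \oo] --> (0 : R) &
            \forall n \near \oo,
              (- lne (risk (t n) i) / (v_opt p i)%:E * (1 + e1 n)%:E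
                 <= mean_time (t n) i)%E /\
              (- lne (Pmax (t n)) / (v_opt p i)%:E * (1 + e2 n)%:E
                 <= - lne (risk (t n) i) / (v_opt p i)%:E * (1 + e1 n)%:E)%E])
  /\
  (forall qs : 'I_M -> Y -> U -> R,
      (forall i, is_maximizer p i (qs i)) ->
      exists2 a0 : R, 1 < a0 &
      forall a : R, 1 < a < a0 ->
      forall (X : controlled_process p y0) (mle : seq (U * Y) -> 'I_M),
        policy X =2 star_policy y0 a qs mle ->
        is_mle X mle ->
        let star := star_test X mle in
        (forall T : R, 0 < T -> (Pmax (star T) <= ((M%:R - 1) / T)%:E)%E) /\
        (forall i : 'I_M,
          [/\ asymp_eq (pinfty_nbhs R)
                (fun T => mean_time (star T) i)
                (fun T => - lne (Pmax (star T)) / (v_opt p i)%:E)%E,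
              asymp_eq (pinfty_nbhs R)
                (fun T => mean_time (star T) i)
                (fun T => inf_mean_time (class_Pmax p y0 (Pmax (star T))) i),
              asymp_eq (pinfty_nbhs R)
                (fun T => mean_time (star T) i)
                (fun T => - lne (risk (star T) i) / (v_opt p i)%:E)%E &
              asymp_eq (pinfty_nbhs R)
                (fun T => mean_time (star T) i)
                (fun T => inf_mean_time (class_risk p y0 (risk (star T))) i)])).
Proof.
split; first exact: (converse hM p_gt0 p_pmf).
move=> qs /[dup] qs_max /(achievability y0 hM p_gt0 p_pmf)[a0 a01 H]; exists a0 => // a aa0.
move=> X mle X_star mleP star; have sup := H a aa0 X mle X_star mleP.
have M0 : (0 < M)%N by exact: ltnW.
have sP (T : R) : 0 < T -> (Pmax (star T) <= ((M%:R - 1) / T)%:E)%E.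
  by move=> T0; exact: star_Pmax.
split=> // i.
(* a looser bound, which holds for the tests with the same risks as well *)
have small (T : R) : 1 < T -> (Pmax (star T) <= ((M%:R * M%:R) / T)%:E)%E.
  move=> T1; have T0 : 0 < T by lra.
  apply: le_trans (sP T T0) _; rewrite lee_fin ler_pM2r ?invr_gt0//.
  have M1 : 1 <= M%:R :> R by rewrite ler1n.
  have : M%:R <= M%:R * M%:R :> R by rewrite ler_peMr.
  by lra.
have conv (e : R) : 0 < e < 1 -> exists2 T0 : R, 1 < T0 &
    forall T (t : sequential_test p y0), T0 < T ->
    (Pmax t <= ((M%:R * M%:R) / T)%:E)%E ->
    (((1 - e) * ln T)%:E / (v_opt p i)%:E <= mean_time t i)%E.
  move=> /andP[e0 e1]; have e2 : 0 < e / 2 < 1 by lra.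
  have [T0 T01 HT0] := converse_uniform y0 hM p_gt0 p_pmf i e2.
  exists T0 => // T t TT0 tP; have [c1 c2 _] := HT0 T t TT0 tP.
  have v0 := inve_v_opt_ge0 hM p_gt0 p_pmf t i.
  apply: le_trans c1; apply: (@le_trans _ _
    (((1 - e / 2) * ln T)%:E / (v_opt p i)%:E * (1 - e / 2)%:E)%E); last first.
    by apply: lee_wpmul2r => //; rewrite lee_fin; lra.
  rewrite muleAC; apply: lee_wpmul2r => //; rewrite -EFinM lee_fin.
  have lT : 0 <= ln T by rewrite ln_ge0//; lra.
  rewrite mulrAC; apply: ler_wpM2r => //.
  by have := sqr_ge0 (e / 2); rewrite expr2; lra.
have inf_le (C : R -> sequential_test p y0 -> Prop) (e : R) : 0 < e < 1 ->
    (forall T, C T (star T)) ->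
    (forall T, 0 < T -> forall t, C T t -> (Pmax t <= ((M%:R * M%:R) / T)%:E)%E) ->
    exists T0 : R, forall T, T0 < T ->
    (((1 - e) * ln T)%:E / (v_opt p i)%:E <= inf_mean_time (C T) i)%E /\
    (inf_mean_time (C T) i * (1 - e)%:E <= mean_time (star T) i)%E.
  move=> e01 Cstar CP; have [T0 T01 HT0] := conv e e01; exists T0 => T TT0; split.
    apply: inf_mean_time_ge => t Ct; apply: HT0 => //; apply: (CP T) => //; lra.
  apply: le_trans (inf_mean_time_le i (Cstar T)); rewrite -[leRHS]mule1.
  apply: lee_wpmul2l; last by rewrite lee_fin; lra.
  by apply: inf_mean_time_ge => t _; exact: mean_time_ge0.
have lower (e : R) : 0 < e < 1 -> exists T0 : R, forall T, T0 < T ->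
    [/\ (- lne (risk (star T) i) / (v_opt p i)%:E * (1 - e)%:E <= mean_time (star T) i)%E,
      (((1 - e) * ln T)%:E / (v_opt p i)%:E <= - lne (risk (star T) i) / (v_opt p i)%:E)%E &
      (((1 - e) * ln T)%:E / (v_opt p i)%:E <= - lne (Pmax (star T)) / (v_opt p i)%:E)%E].
  move=> e01; have [T0 T01 HT0] := converse_uniform y0 hM p_gt0 p_pmf i e01.
  by exists T0 => T TT0; apply: HT0 => //; apply: small; lra.
split; apply: (mean_time_asymp_eq hM p_gt0 p_pmf sP (sup i)) => e e01.
- have [T0 HT0] := lower e e01; exists T0 => T /HT0[l1 l2 l3]; split => //.
  apply: le_trans l1; apply: lee_wpmul2r; first by rewrite lee_fin; lra.
  apply: lee_wpmul2r; first exact: (inve_v_opt_ge0 hM p_gt0 p_pmf (star T) i).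
  by apply: le_oppe_lne; [exact: risk_ge0 | exact: risk_le_Pmax].
- apply: (inf_le (fun T => class_Pmax p y0 (Pmax (star T)))) => // [T|T T0 t tP].
    exact: lexx.
  apply: le_trans tP _; apply: le_trans (sP T T0) _.
  rewrite lee_fin ler_pM2r ?invr_gt0//.
  have M1 : 1 <= M%:R :> R by rewrite ler1n.
  have : M%:R <= M%:R * M%:R :> R by rewrite ler_peMr.
  by lra.
- by have [T0 HT0] := lower e e01; exists T0 => T /HT0[l1 l2 l3].
- apply: (inf_le (fun T => class_risk p y0 (risk (star T)))) => // [T k|T T0 t tR].
    exact: lexx.
  have MT0 : 0 <= (M%:R - 1) / T :> R.
    by apply: divr_ge0; [rewrite subr_ge0 ler1n | exact: ltW].
  apply: le_trans (Pmax_le_risk MT0 _) _ => [k|].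
    apply: le_trans (tR k) _; apply: le_trans (sP T T0); exact: risk_le_Pmax.
  rewrite lee_fin mulrA ler_pM2r ?invr_gt0// ler_wpM2l//.
  by lra.
Qed.
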